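(* There exists an absolute constant $C>0$ such that the following holds. Let $d$ be a positive integer, let $\lambda$ be a partition of $n$ of level $d$, let $\mu,\nu$ be partitions of $n$, and let $q=\frac{\log(\chi_\mu(1)\chi_\nu(1))}{d}$. If $q\ge2$, then $$g(\lambda,\mu,\nu)\le\left(\frac{Cq}{\log q}\right)^{d}\left(\frac{\chi_\lambda(1)d^{d}}{n^{d}}\right)^{1-2/q}.$$
   Context: For a partition $\lambda=(\lambda_1\ge\lambda_2\ge\cdots)$ of $n$, $\chi_\lambda$ is the corresponding irreducible complex character of the symmetric group $S_n$. Write $\lambda'$ for the conjugate partition, so $\lambda_1'$ is the number of parts of $\lambda$. The level of $\lambda$ (equivalently of $\chi_\lambda$) is $\min(n-\lambda_1,\,n-\lambda_1')$. The Kronecker coefficient is $g(\lambda,\mu,\nu)=\frac{1}{n!}\sum_{\sigma\in S_n}\chi_\lambda(\sigma)\chi_\mu(\sigma)\chi_\nu(\sigma)$, i.e. the multiplicity of the Specht module $V_\nu$ in $V_\lambda\otimes V_\mu$. The logarithm is natural. *)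

(* Defs.v *)
From HB Require Import structures.
From mathcomp Require Import all_boot all_order all_algebra all_fingroup.
From mathcomp Require Import all_solvable all_field all_character.
From mathcomp Require Import reals exp.

Set Implicit Arguments.
Unset Strict Implicit.
Unset Printing Implicit Defensive.

Import Order.TTheory GRing.Theory Num.Theory GroupScope.
Local Open Scope ring_scope.

Definition is_intpart (n : nat) (la : seq nat) : bool :=
  [&& sorted geq la, 0%N \notin la & sumn la == n].

Record intpart (n : nat) : Type := IntPart {
  parts :> seq nat;
  intpartP : is_intpart n parts
}.

(* The conjugate partition has first part [size la]. *)
Definition level (n : nat) (la : intpart n) : nat :=
  minn (n - head 0%N la) (n - size la).

(* The canonical tableau of shape [la] is filled with 0, 1, ..., n - 1 along
   successive rows: the entry i lies in row [reshape_index la i] and column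
   [reshape_offset la i]. *)
Definition row_stab (n : nat) (la : intpart n) : {set 'S_n} :=
  [set s : 'S_n |
    [forall i : 'I_n, reshape_index la (s i) == reshape_index la i]].

Definition col_stab (n : nat) (la : intpart n) : {set 'S_n} :=
  [set s : 'S_n |
    [forall i : 'I_n, reshape_offset la (s i) == reshape_offset la i]].

(* Group algebra elements are row vectors in the basis of the regular
   representation: [gring_index _ x] is the position of x. *)
Definition young_symmetrizer (n : nat) (la : intpart n) :
    'rV[algC]_#|[set: 'S_n]| :=
  \sum_(p in row_stab la) \sum_(q in col_stab la)
    (-1) ^+ odd_perm q *: delta_mx 0 (gring_index [set: 'S_n] (p * q)%g).

Definition specht_repr (n : nat) (la : intpart n) :=
  submod_repr
    (cyclic_mx_module (regular_repr algC [set: 'S_n]%G) (young_symmetrizer la)).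

Definition chi (n : nat) (la : intpart n) : 'CF([set: 'S_n]) :=
  cfRepr (specht_repr la).

Definition kronecker (n : nat) (la mu nu : intpart n) : algC :=
  (n`!%:R)^-1 * \sum_(s : 'S_n) chi la s * chi mu s * chi nu s.

(* [algC] does not embed in a [realType], so chi(1) and the Kronecker
   coefficient are also given as natural numbers; nothing is lost by the
   truncation, by [chi_degE] and [kronE]. *)
Definition chi_deg (n : nat) (la : intpart n) : nat :=
  Num.truncn (chi la 1%g).

Definition kron (n : nat) (la mu nu : intpart n) : nat :=
  Num.truncn (kronecker la mu nu).

Lemma chi_char (n : nat) (la : intpart n) : chi la \is a character.
Proof. exact: cfRepr_char. Qed.

Lemma chi_degE (n : nat) (la : intpart n) : (chi_deg la)%:R = chi la 1%g.
Proof. by rewrite /chi_deg /chi cfRepr1 natrK. Qed.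

Lemma kronecker_cfdot (n : nat) (la mu nu : intpart n) :
  kronecker la mu nu = '[chi la * chi mu * chi nu, 1].
Proof.
rewrite /kronecker cfdotE cardsT card_Sn; congr (_ * _).
apply: eq_big => [s|s _]; first by rewrite inE.
by rewrite !cfunE cfun1E inE conjC1 mulr1.
Qed.

Lemma kronE (n : nat) (la mu nu : intpart n) :
  (kron la mu nu)%:R = kronecker la mu nu.
Proof.
rewrite /kron truncnK // kronecker_cfdot.
by rewrite Cnat_cfdot_char ?cfun1_char ?rpredM ?chi_char.
Qed.

(* Main.v *)
Require Import Defs.
From mathcomp Require Import all_boot all_order all_algebra all_fingroup.
From mathcomp Require Import all_solvable all_field all_character.
From mathcomp Require Import reals sequences exp.
From mathcomp Require Import zify ring lra.

(** Write chi for the character of la, whose level is d, and phi for the product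
of the characters of mu and nu, so that the Kronecker coefficient is the scalar
product of chi and phi.  Twisting by the sign exchanges rows and columns, so
let the d cells of la outside its first row form the set L, and let chi' be the
irreducible character of Sym L attached to them.

The Young symmetrizer of la is a right multiple of the product of the
symmetrizer of the first row with the Young symmetrizer of L.  Hence chi is
contained in the character induced from chi' on the Young subgroup
H = Sym L x Sym (~: L), and the Kronecker coefficient is at most the mean over
H of chi' phi ([multiplicity_le]).

This mean is bounded by Hoelder's inequality.  By definition of q, |phi| is
bounded by e ^ (q d), and its mean over the whole group is at most 1 by Cauchy
and Schwarz.  Let N (g) be the number of g-invariant
sets of d cells.  The mean of |phi| / N over H is at most the mean of |phi|
over the whole group, because N (g) counts the images of L
under the group whose stabilizer contains g, and H is the stabilizer of L.
The power mean inequality with weights |phi| / N applied to chi' N then leaves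
the mean over H of |chi'| ^ q N ^ (q - 1) ([restriction_bound]).  Up to a
factor 2 ^ d the function N depends on the component in Sym (~: L) only, so
this mean splits into two: that of |chi'| ^ q, which is at most
chi' (1) ^ (q - 2) since chi' has norm 1, and a moment of the number of
invariant subsets with at most d elements of a random permutation.

The P-th moment counts P-tuples of subsets up to permutation, that is,
multisets of colours; weighting a subset A by x ^ |A| bounds it by
x ^ (- d P) exp (2 (1 + x) ^ P) ([moment_small_invariant]).  With
x = ln q / (2 q) this gives (C q / ln q) ^ d once the q-th root is taken.

The bound obtained so far involves chi' (1) instead of chi (1) (d / n) ^ d.
The matrix of the Young symmetrizer of la contains a block diagonal submatrix
with binomial (n - m) d copies of that of L, for some m <= d
([young_rank_lower]); since this binomial coefficient is at least
(n / (3 d)) ^ d, the replacement costs a factor 3 ^ d.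

All characters involved are integer valued, which is how inequalities between
algebraic numbers become inequalities between real numbers. *)

Set Implicit Arguments.
Unset Strict Implicit.
Unset Printing Implicit Defensive.

Import Order.TTheory GRing.Theory Num.Theory GroupScope.
Local Open Scope ring_scope.

Local Notation Sym := perm.Sym.
Local Notation Sym_group := perm.Sym_group.

(** * Right ideals of the group algebra *)

Section RightIdeals.

Variables (gT : finGroupType) (K : {group gT}).
Implicit Types (w v : gT -> algC) (x y z g : gT).

(** An element of the group algebra as a vector of the regular representation. *)
Definition gal_row w : 'rV[algC]_#|K| := \row_j w (enum_val j).

(** The row of index i is the product of w with the i-th element of K, so the
row space is the right ideal generated by w. *)
Definition lmul_mx w : 'M[algC]_#|K| :=
  \matrix_(i, j) w (enum_val j * (enum_val i)^-1)%g.

Definition ideal_mx w := cyclic_mx (regular_repr algC K) (gal_row w).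

Definition ideal_char w : 'CF(K) :=
  cfRepr (submod_repr (cyclic_mx_module (regular_repr algC K) (gal_row w))).

Lemma regular_mxE x i j : x \in K ->
  regular_mx algC K x i j = (enum_val j == enum_val i * x)%g%:R.
Proof.
move=> Kx; rewrite mxE mxE /=; congr (nat_of_bool _)%:R.
by rewrite -(inj_eq enum_val_inj) gring_indexK // groupM ?enum_valP.
Qed.

Lemma gal_row_regular w (i : 'I_#|K|) :
  gal_row w *m regular_repr algC K (enum_val i) = row i (lmul_mx w).
Proof.
apply/rowP=> j; rewrite /= !mxE.
have Kji : (enum_val j * (enum_val i)^-1)%g \in K by rewrite groupM ?groupV ?enum_valP.
rewrite (bigD1 (gring_index K (enum_val j * (enum_val i)^-1)%g)) //=.
rewrite regular_mxE ?enum_valP // mxE gring_indexK // mulgKV eqxx mulr1.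
rewrite big1 ?addr0 // => k nk; rewrite regular_mxE ?enum_valP //.
case: eqP => [def_j|]; last by rewrite mulr0.
by case/eqP: nk; apply: enum_val_inj; rewrite gring_indexK // def_j mulgK.
Qed.

Lemma ideal_mxE w : (ideal_mx w :=: lmul_mx w)%MS.
Proof.
apply/eqmxP/andP; split; last first.
  apply/row_subP=> i; rewrite -gal_row_regular.
  apply/cyclic_mxP; exists (regular_repr algC K (enum_val i)) => //.
  by rewrite envelop_mx_id ?enum_valP.
rewrite /ideal_mx genmxE; apply/row_subP=> i; rewrite row_mul rowK mul_rV_lin1 /= mxvecK.
by rewrite gal_row_regular row_sub.
Qed.

Lemma ideal_char1 w : ideal_char w 1%g = (\rank (lmul_mx w))%:R.
Proof. by rewrite cfRepr1 (ideal_mxE w). Qed.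

Lemma sum_enum_val (F : gT -> algC) : \sum_(i < #|K|) F (enum_val i) = \sum_(x in K) F x.
Proof. by rewrite [RHS]big_enum_val. Qed.

Lemma lmul_mxM w v : lmul_mx w *m lmul_mx v =
  lmul_mx (fun x => \sum_(y in K) v y * w (y^-1 * x)%g).
Proof.
apply/matrixP=> i j; rewrite !mxE.
under eq_bigr do rewrite !mxE.
rewrite (sum_enum_val (fun z => w (z * (enum_val i)^-1)%g * v (enum_val j * z^-1)%g)).
rewrite (reindex_inj (inj_comp (mulIg (enum_val j)) invg_inj)) /=.
apply: eq_big => [x|x _]; first by rewrite groupMr ?groupV ?enum_valP.
by rewrite invMg invgK mulKVg mulgA mulrC.
Qed.

Lemma mxtrace_lmul w : \tr (lmul_mx w) = #|K|%:R * w 1%g.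
Proof.
rewrite /mxtrace; under eq_bigr do rewrite mxE mulgV.
by rewrite sumr_const card_ord mulr_natl.
Qed.

Lemma eq_lmul_mx w v : {in K, w =1 v} -> lmul_mx w = lmul_mx v.
Proof. by move=> wv; apply/matrixP=> i j; rewrite !mxE wv // groupM ?groupV ?enum_valP. Qed.

(** In the group algebra, w * w = k w. *)
Definition quasi_idem w (k : algC) :=
  {in K, forall x, \sum_(y in K) w y * w (y^-1 * x)%g = k * w x}.

Lemma quasi_idem_mx w k : quasi_idem w k -> lmul_mx w *m lmul_mx w = k *: lmul_mx w.
Proof.
move=> ww; rewrite lmul_mxM (eq_lmul_mx ww).
by apply/matrixP=> i j; rewrite !mxE.
Qed.

(** If w * w = 0 and the matrix of w factors as C B with C and B of full rank,
then B C = 0, so this matrix has trace 0; but its trace is #|K| w (1). *)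
Lemma quasi_idem_neq0 w k : quasi_idem w k -> w 1%g != 0 -> k != 0.
Proof.
move/quasi_idem_mx=> ww w1; apply: contra w1 => /eqP k0.
have nK : (#|K|%:R : algC) != 0 by rewrite pnatr_eq0 -lt0n cardG_gt0.
rewrite -(mulrI_eq0 _ (mulfI nK)) -mxtrace_lmul.
rewrite -[lmul_mx w]mulmx_base mxtrace_mulC.
set C := col_base _; set B := row_base _.
have CBCB : C *m (B *m C) *m B = 0.
  have CB : C *m B = lmul_mx w by exact: mulmx_base.
  by rewrite -[LHS]mulmxA -[X in _ *m X]mulmxA mulmxA CB ww k0 scale0r.
suff -> : B *m C = 0 by rewrite mxtrace0.
apply: (row_full_inj (col_base_full (lmul_mx w))).
apply: (row_free_inj (row_base_free (lmul_mx w))).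
by rewrite /= -/B -/C CBCB mulmx0 mul0mx.
Qed.

(** E is a projection onto U, so composing with E extends an endomorphism of U to
the whole space without changing its trace. *)
Lemma mxtrace_submod_proj n (rG : mx_representation algC K n) (U E : 'M_n)
    (modU : mxmodule rG U) x : x \in K ->
  (E <= U)%MS -> U *m E = U -> \tr (submod_mx modU x) = \tr (rG x *m E).
Proof.
move=> Kx sEU UE; rewrite /submod_mx -[X in \tr (rG x *m X)](in_submodK sEU).
rewrite [val_submod (in_submod U E)]val_submodE.
set B := val_submod 1%:M.
rewrite mulmxA [RHS]mxtrace_mulC; congr (\tr _).
rewrite in_submodE [in_submod U E]in_submodE !mulmxA; congr (_ *m _).
have /submxP[D ->] : (B *m rG x <= U)%MS.
  by apply: submx_trans (mxmoduleP modU x Kx); rewrite submxMr // val_submodP.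
by rewrite -(mulmxA D U E) UE.
Qed.

(** Left multiplication by the idempotent w / k is a projection onto the ideal
that commutes with the regular representation. *)
Lemma ideal_charE w k g : quasi_idem w k -> w 1%g != 0 -> g \in K ->
  ideal_char w g = k^-1 * \sum_(x in K) w (x * g^-1 * x^-1)%g.
Proof.
move=> ww w1 Kg; have nzk := quasi_idem_neq0 ww w1.
rewrite cfunE Kg mulr1n.
rewrite (@mxtrace_submod_proj _ _ _ (k^-1 *: lmul_mx w)) //; last first.
- rewrite -[cyclic_mx _ _]/(ideal_mx w).
  have /submxP[D ->] : (ideal_mx w <= lmul_mx w)%MS by rewrite ideal_mxE.
  by rewrite -scalemxAr -mulmxA (quasi_idem_mx ww) -!scalemxAr scalerA mulVf // scale1r.
- by rewrite scalemx_sub // -[cyclic_mx _ _]/(ideal_mx w) ideal_mxE.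
rewrite -scalemxAr mxtraceZ /mxtrace; congr (_ * _).
rewrite -(sum_enum_val (fun x => w (x * g^-1 * x^-1)%g)); apply: eq_bigr => i _.
rewrite mxE (bigD1 (gring_index K (enum_val i * g)%g)) //=.
have Kig : (enum_val i * g)%g \in K by rewrite groupM ?enum_valP.
rewrite regular_mxE // mxE gring_indexK // eqxx mul1r invMg mulgA.
rewrite big1 ?addr0 // => j nj; rewrite regular_mxE //.
case: eqP => [def_j|]; last by rewrite mul0r.
by case/eqP: nj; apply: enum_val_inj; rewrite gring_indexK.
Qed.

(** The last hypothesis says that the products w z w span a line, that is, that
the ideal has no endomorphisms but scalars.  The trace formula turns the norm
into k ^ (- 2) times the coefficient of 1 in w * w * w. *)
Lemma ideal_char_norm w k (l : gT -> algC) :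
  quasi_idem w k -> w 1%g = 1 ->
  {in K &, forall z x, \sum_(y in K) w y * w (z^-1 * y^-1 * x)%g = l z * w x} ->
  '[ideal_char w] = 1.
Proof.
move=> ww w1 lw; have nzw : w 1%g != 0 by rewrite w1 oner_eq0.
have nzk := quasi_idem_neq0 ww nzw.
have lE z : z \in K -> l z = \sum_(y in K) w y * w (z^-1 * y^-1)%g.
  move=> Kz; rewrite -[LHS]mulr1 -w1 -lw //.
  by apply: eq_bigr => y _; rewrite mulg1.
rewrite cfdotE.
transitivity (#|K|%:R^-1 * \sum_(g in K) (k^-1 * \sum_(x in K) w (x * g^-1 * x^-1)%g) *
   (k^-1 * \sum_(y in K) w (y * g * y^-1)%g)).
  congr (_ * _); apply: eq_bigr => g Kg.
  have <- : ideal_char w g^-1%g = (ideal_char w g)^*.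
    by rewrite char_inv // cfRepr_char.
  by rewrite !(ideal_charE ww) ?groupV // invgK.
have reidx (g x y : gT) :
    w (x * g^-1 * x^-1)%g * w (y * g * y^-1)%g =
    (fun h z => w h * w (z^-1 * h^-1 * z)%g) (x * g^-1 * x^-1)%g (x * y^-1)%g.
  by rewrite /= !invMg !invgK !mulgA mulgKV mulgKV.
transitivity (#|K|%:R^-1 * (k^-1 ^+ 2 * \sum_(x in K) \sum_(y in K) \sum_(g in K)
    w g * w (y^-1 * g^-1 * y)%g)).
  congr (_ * _); rewrite mulr_sumr.
  under eq_bigr do rewrite mulrACA -expr2 big_distrlr mulr_sumr /=.
  rewrite exchange_big /= mulr_sumr; apply: eq_bigr => x Kx.
  rewrite -[LHS]mulr_sumr -[RHS]mulr_sumr exchange_big /=; congr (_ * _).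
  rewrite [RHS](reindex_inj (inj_comp (mulgI x) invg_inj)) /=.
  apply: eq_big => [y|y Ky]; first by rewrite groupMl // groupV.
  rewrite [RHS](reindex_inj (inj_comp (conjg_inj x^-1%g) invg_inj)) /=.
  apply: eq_big => [g|g Kg]; first by rewrite memJ_norm ?groupV // (subsetP (normG K)) ?groupV.
  by rewrite reidx // /conjg invgK !mulgA.
have Y : \sum_(y in K) \sum_(g in K) w g * w (y^-1 * g^-1 * y)%g = k ^+ 2.
  transitivity (\sum_(y in K) w y * \sum_(g in K) w g * w (y^-1 * g^-1)%g).
    by apply: eq_bigr => y Ky; rewrite lw // mulrC -lE.
  under eq_bigr do rewrite mulr_sumr.
  rewrite exchange_big /=.
  transitivity (\sum_(g in K) w g * (k * w g^-1%g)).
    apply: eq_bigr => g Kg; rewrite -ww ?groupV // mulr_sumr.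
    by apply: eq_bigr => y _; rewrite mulrCA.
  under eq_bigr do rewrite mulrCA.
  rewrite -mulr_sumr expr2; congr (_ * _).
  have := ww 1%g (group1 K); rewrite w1 mulr1 => <-.
  by apply: eq_bigr => g _; rewrite mulg1.
have nK : (#|K|%:R : algC) != 0 by rewrite pnatr_eq0 -lt0n cardG_gt0.
under eq_bigr do rewrite Y.
rewrite sumr_const -[k ^+ 2 *+ _]mulr_natl.
by rewrite (mulrCA (k^-1 ^+ 2)) mulKf // -exprMn mulVf // expr1n.
Qed.

(** A right multiple of w generates a submodule of the ideal of w, which has a
complement by Maschke's theorem. *)
Lemma ideal_char_sub w v f :
  {in K, forall x, v x = \sum_(y in K) w y * f (y^-1 * x)%g} ->
  ideal_char w - ideal_char v \is a character.
Proof.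
move=> wf.
have sVW : (ideal_mx v <= ideal_mx w)%MS.
  by rewrite !ideal_mxE (eq_lmul_mx wf) -lmul_mxM submxMl.
set modV := cyclic_mx_module (regular_repr algC K) (gal_row v).
set modW := cyclic_mx_module (regular_repr algC K) (gal_row w).
have [U modU defW dxW] := mx_reducibleS modW (submx1 _)
  (mx_Maschke_pchar _ (algC'G_pchar K)) modV sVW.
suff -> : ideal_char w - ideal_char v = cfRepr (submod_repr modU) by exact: cfRepr_char.
apply/cfun_inP=> x Kx; rewrite !cfunE Kx !mulr1n.
by rewrite -(mxtrace_dadd_mod modV modU modW defW dxW Kx) addrC addKr.
Qed.

End RightIdeals.

(** * Young symmetrizers *)

Section Tableaux.

Variable T : finType.
Implicit Types (S : {set T}) (r c f : T -> nat) (g p q : {perm T}).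

(** Where f and g disagree at x, counting gives a point y with g y = f x and
f y != f x; composing g with the transposition of x and y repairs x and
creates no new disagreement. *)
Lemma exists_perm_fiber (A : eqType) S (f g : T -> A) :
    {in ~: S, f =1 g} -> (forall a, #|[set x | f x == a]| = #|[set x | g x == a]|) ->
  exists2 s : {perm T}, s \in Sym S & forall x, f x = g (s x).
Proof.
have [m] := ubnP #|[set x | f x != g x]|; elim: m g => // m IHm g lt_m fgS fg.
have [x nfg|eqfg] := pickP [pred x | f x != g x]; last first.
  by exists 1%g => [|x]; rewrite ?group1 // perm1; apply/eqP/negbFE/eqfg.
have [y gy fy] : exists2 y, g y = f x & f y != f x.
  have [y /andP[/eqP]|no_y] := pickP [pred y | (g y == f x) && (f y != f x)]; first by exists y.
  have sgf : [set y | g y == f x] \subset [set y | f y == f x].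
    by apply/subsetP=> y; rewrite !inE => gy; have /= := no_y y; rewrite gy => /negbFE.
  have /eqP/setP/(_ x) : [set y | g y == f x] == [set y | f y == f x].
    by rewrite eqEcard sgf fg leqnn.
  by rewrite !inE eqxx eq_sym (negbTE nfg).
have Sx : x \in S by apply: contraNT nfg => nSx; rewrite /= fgS ?inE.
have Sy : y \in S by apply: contraNT fy => nSy; rewrite fgS ?inE // gy.
have tS : tperm x y \in Sym S.
  rewrite inE; apply: subset_trans (tperm_on x y) _.
  by apply/subsetP=> z; rewrite !inE => /orP[]/eqP->.
have [||| s Ss fE] := IHm (g \o tperm x y).
- rewrite -ltnS; apply: leq_trans lt_m; apply/proper_card/properP; split; last first.
    by exists x; rewrite !inE //= tpermL gy eqxx.
  apply/subsetP=> z; rewrite !inE /=; case: tpermP => // ->; first by rewrite gy eqxx.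
  by rewrite gy.
- move=> z nSz; rewrite /= tpermD ?fgS //; apply: contraTneq nSz => <-; rewrite inE negbK //.
- move=> a; rewrite fg -(card_preimset [set z | g z == a] (@perm_inj _ (tperm x y))).
  by apply: eq_card => z; rewrite !inE.
exists (s * tperm x y)%g; first by rewrite groupM.
by move=> z; rewrite permM fE.
Qed.

Definition stab_in S f := [set p in Sym S | [forall x, f (p x) == f x]].

Lemma stab_inP S f p :
  reflect (p \in Sym S /\ forall x, f (p x) = f x) (p \in stab_in S f).
Proof.
apply: (iffP setIdP) => [[-> /forallP pf]|[-> pf]]; split=> //.
  by move=> x; apply/eqP.
by apply/forallP=> x; apply/eqP.
Qed.

Lemma stab_in_group_set S f : group_set (stab_in S f).
Proof.
apply/group_setP; split=> [|p q /stab_inP[Sp fp] /stab_inP[Sq fq]].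
  by apply/stab_inP; split=> [|x]; rewrite ?group1 ?perm1 //.
by apply/stab_inP; split=> [|x]; rewrite ?groupM // permM fq.
Qed.
Canonical stab_in_group S f := Group (stab_in_group_set S f).

(** The row symmetrizer times the signed column symmetrizer, for the tableau that
puts the cell x of S in row r x and column c x. *)
Definition young S r c : {perm T} -> algC := fun g =>
  \sum_(p in stab_in S r) \sum_(q in stab_in S c | (p * q)%g == g) (-1) ^+ odd_perm q.

Lemma young_Ml S r c p g : p \in stab_in S r -> young S r c (p * g)%g = young S r c g.
Proof.
move=> Rp; rewrite /young (reindex_inj (mulgI p)) /=.
apply: eq_big => [p'|p' _]; first by rewrite groupMl.
by apply: eq_bigl => q; rewrite -mulgA (inj_eq (mulgI p)).
Qed.

Lemma young_Mr S r c g q : q \in stab_in S c ->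
  young S r c (g * q)%g = (-1) ^+ odd_perm q * young S r c g.
Proof.
move=> Cq; rewrite /young mulr_sumr; apply: eq_bigr => p _.
rewrite mulr_sumr (reindex_inj (mulIg q)) /=.
apply: eq_big => [q'|q' _]; first by rewrite groupMr // mulgA (inj_eq (mulIg q)).
by rewrite odd_permM signr_addb mulrC.
Qed.

Definition injective_on S r c := {in S &, forall x y, r x = r y -> c x = c y -> x = y}.

(** With r and c exchanged this says that columns have no gaps, so both together
describe the diagram of a partition. *)
Definition left_justified S r c :=
  forall x j, x \in S -> (j < c x)%N -> exists2 y, y \in S & r y = r x /\ c y = j.

Lemma stab_in_meet S r c p : injective_on S r c ->
  p \in stab_in S r -> p \in stab_in S c -> p = 1%g.
Proof.
move=> rc_inj /stab_inP[Sp rp] /stab_inP[_ cp]; apply/permP=> x; rewrite perm1.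
have [Sx|nSx] := boolP (x \in S); last by move: Sp; rewrite inE => /out_perm->.
by apply: rc_inj => //; move: Sp; rewrite inE => /perm_closed->.
Qed.

Lemma young1 S r c : injective_on S r c -> young S r c 1%g = 1.
Proof.
move=> rc_inj; rewrite /young (bigD1 1%g) ?group1 //= (big_pred1 1%g).
  rewrite odd_perm1 expr0 big1 ?addr0 // => p /andP[Rp p1].
  rewrite big_pred0 // => q; apply: contraNF p1 => /andP[Cq /eqP pq1].
  apply/eqP/(stab_in_meet rc_inj Rp); rewrite -[p]invgK groupV.
  by rewrite -(mulgK q p) pq1 mul1g invgK.
by move=> q; rewrite /= mul1g andb_idl // => /eqP->; rewrite group1.
Qed.

(** For every m, a row has at most as many cells sent to the first m columns as it
has cells in the first m columns, since the images lie in distinct columns.  Both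
counts have the same sum over all rows because g permutes the cells, so they
agree in every row, and hence for every single column. *)
Lemma row_meets_image_col S r c g : injective_on S r c -> left_justified S r c -> g \in Sym S ->
    (forall x y, x \in S -> y \in S -> r x = r y -> c (g x) = c (g y) -> x = y) ->
  forall x, x \in S -> exists2 y, y \in S & r y = r x /\ c y = c (g x).
Proof.
move=> rc_inj rc_just Sg g_inj x Sx.
have gS y : (g y \in S) = (y \in S) by move: Sg; rewrite inE => /perm_closed->.
pose A m i := [set y in S | (r y == i) && (c (g y) < m)%N].
pose B m i := [set y in S | (r y == i) && (c y < m)%N].
have leAB m i : (#|A m i| <= #|B m i|)%N.
  have [le_m|/subsetPn[z]] := boolP ([set y in S | r y == i] \subset B m i).
    apply/subset_leq_card/(subset_trans _ le_m)/subsetP => y.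
    by rewrite !inE => /and3P[-> ->].
  rewrite !inE => /andP[Sz /eqP rz]; rewrite Sz rz eqxx /= -leqNgt => le_mz.
  have le_m : (#|A m i| <= m)%N.
    rewrite -[m in leqRHS](size_iota 0) cardE.
    rewrite -(size_map (fun y => c (g y))); apply: uniq_leq_size.
      rewrite map_inj_in_uniq ?enum_uniq // => y1 y2.
      rewrite !mem_enum !inE => /and3P[S1 /eqP r1 _] /and3P[S2 /eqP r2 _].
      by apply: g_inj => //; rewrite r1.
    move=> j /mapP[y]; rewrite mem_enum !inE => /and3P[_ _ lt_m] ->.
    by rewrite mem_iota add0n.
  apply: leq_trans le_m _; rewrite -[m in leqLHS](size_iota 0) cardE.
  rewrite -(size_map c); apply: uniq_leq_size; first exact: iota_uniq.
  move=> j; rewrite mem_iota add0n /= => lt_jm.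
  have [y Sy [ry cy]] : exists2 y, y \in S & r y = r z /\ c y = j.
    have [lt_j|le_j] := ltnP j (c z); first exact: rc_just.
    exists z => //; split=> //; apply/eqP; rewrite eqn_leq le_j.
    by rewrite (leq_trans _ le_mz) // ltnW.
  by apply/mapP; exists y => //; rewrite mem_enum !inE Sy ry rz eqxx cy.
(* Rows are indexed by a finite type in order to sum over them. *)
pose h (y : T) : 'I_(\max_y r y).+1 := inord (r y).
have hE y (i : 'I_(\max_y r y).+1) : (h y == i) = (r y == i).
  by rewrite -val_eqE /= inordK // ltnS leq_bigmax.
have sumAB m : (\sum_(i < (\max_y r y).+1) #|A m i| = \sum_(i < (\max_y r y).+1) #|B m i|)%N.
  transitivity #|[set y in S | c (g y) < m]%N|.
    rewrite -sum1_card [RHS](partition_big h xpredT) //=; apply: eq_bigr => i _.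
    rewrite -sum1_card; apply: eq_bigl => y; rewrite !inE hE -andbA.
    by case: (y \in S) => //=; rewrite andbC.
  transitivity #|[set y in S | c y < m]%N|.
    rewrite -(card_preimset [set y in S | c y < m]%N (@perm_inj _ g)).
    by apply: eq_card => y; rewrite !inE gS.
  rewrite -sum1_card (partition_big h xpredT) //=; apply: eq_bigr => i _.
  rewrite -sum1_card; apply: eq_bigl => y; rewrite !inE hE -andbA.
  by case: (y \in S) => //=; rewrite andbC.
have eqAB m y : #|A m (r y)| = #|B m (r y)|.
  have := leqif_sum (fun (i : 'I_(\max_y r y).+1) (_ : true) => leqif_eq (leAB m i)).
  case=> _ /esym; rewrite sumAB eqxx => /forallP/(_ (h y))/eqP.
  by rewrite inordK // ltnS leq_bigmax.
have ltA : (#|A (c (g x)) (r x)| < #|A (c (g x)).+1 (r x)|)%N.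
  apply/proper_card/properP; split; last first.
    by exists x; rewrite !inE Sx eqxx ?ltnSn ?ltnn.
  by apply/subsetP=> y; rewrite !inE => /and3P[-> -> lty]; rewrite ltnW.
rewrite !eqAB in ltA.
have /subsetPn[y] : ~~ (B (c (g x)).+1 (r x) \subset B (c (g x)) (r x)).
  by apply: contraL ltA => /subset_leq_card; rewrite leqNgt.
rewrite !inE => /and3P[Sy /eqP ry]; rewrite Sy ltnS ry eqxx /= => le_y ge_y.
by exists y => //; split=> //; apply/eqP; rewrite eqn_leq le_y leqNgt.
Qed.

(** When g separates the cells of each row into distinct columns,
[row_meets_image_col] provides p, which moves every cell along its row into the
column of its image under g. *)
Lemma young_dichotomy S r c g : injective_on S r c -> left_justified S r c -> g \in Sym S ->
  (exists p q, [/\ p \in stab_in S r, q \in stab_in S c & g = p * q]%g) \/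
  (exists x y, [/\ x \in S, y \in S, x != y, r x = r y & c (g x) = c (g y)]).
Proof.
move=> rc_inj rc_just Sg.
have [/exists_inP[x Sx /exists_inP[y Sy /and3P[nxy /eqP rxy /eqP cxy]]]|no_xy] :=
  boolP [exists x in S, exists y in S, [&& x != y, r x == r y & c (g x) == c (g y)]].
  by right; exists x, y.
left; have g_inj x y : x \in S -> y \in S -> r x = r y -> c (g x) = c (g y) -> x = y.
  move=> Sx Sy rxy cxy; apply: contraNeq no_xy => nxy.
  by apply/exists_inP; exists x => //; apply/exists_inP; exists y => //; rewrite nxy rxy cxy !eqxx.
have pP := row_meets_image_col rc_inj rc_just Sg g_inj.
pose p0 x := if [pick y in S | (r y == r x) && (c y == c (g x))] is Some y then
  if x \in S then y else x else x.
have p0S x : x \in S -> [/\ p0 x \in S, r (p0 x) = r x & c (p0 x) = c (g x)].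
  move=> Sx; rewrite /p0; case: pickP => [y /and3P[Sy /eqP ry /eqP cy]|noy]; rewrite ?Sx //.
  by have [y Sy [ry cy]] := pP x Sx; have := noy y; rewrite /= Sy ry cy !eqxx.
have p0N x : x \notin S -> p0 x = x.
  by move=> nSx; rewrite /p0 (negbTE nSx); case: pickP.
have p0_inj : injective p0.
  move=> x y; have [Sx|nSx] := boolP (x \in S); have [Sy|nSy] := boolP (y \in S).
  - have [_ rx cx] := p0S x Sx; have [_ ry cy] := p0S y Sy => eqp.
    by apply: g_inj => //; [rewrite -rx eqp | rewrite -cx eqp].
  - by rewrite (p0N y) // => def_y; case/negP: nSy; rewrite -def_y; case: (p0S x Sx).
  - by rewrite (p0N x) // => def_x; case/negP: nSx; rewrite def_x; case: (p0S y Sy).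
  - by rewrite !p0N.
pose p := perm p0_inj; exists p, (p^-1 * g)%g.
have Sp : p \in Sym S.
  by rewrite inE; apply/subsetP=> x; rewrite inE; apply: contraR => /p0N; rewrite permE => ->.
split; last by rewrite mulKVg.
  apply/stab_inP; split=> // x; rewrite permE.
  by have [/p0S[]|/p0N->] := boolP (x \in S).
apply/stab_inP; split=> [|x]; first by rewrite groupM ?groupV.
rewrite -{2}[x](permKV p) permM; set y := (p^-1)%g x.
rewrite [p y]permE; have [/p0S[_ _ ->] //|nSy] := boolP (y \in S).
by rewrite p0N //; move: Sg; rewrite inE => /out_perm->.
Qed.

(** Von Neumann's lemma.  The symmetries determine z on the products p q.  Any
other g sends two cells of a row into the same column, and applying the
transposition of these two cells on the left, or of their images on the right,
shows that z g is its own opposite. *)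
Lemma young_unique S r c (z : {perm T} -> algC) :
    injective_on S r c -> left_justified S r c ->
    {in stab_in S r & Sym S, forall p g, z (p * g)%g = z g} ->
    {in Sym S & stab_in S c, forall g q, z (g * q)%g = (-1) ^+ odd_perm q * z g} ->
  {in Sym S, forall g, z g = z 1%g * young S r c g}.
Proof.
move=> rc_inj rc_just zR zC g Sg.
have [[p [q [Rp Cq ->]]]|[x [y [Sx Sy nxy rxy cxy]]]] := young_dichotomy rc_inj rc_just Sg.
  have [[Sp _] [Sq _]] := (stab_inP _ _ _ Rp, stab_inP _ _ _ Cq).
  have := young_Mr r 1%g Cq; have := zC 1%g q (group1 _) Cq.
  rewrite !mul1g => zq yq; rewrite zR // young_Ml // zq yq.
  by rewrite young1 // mulr1 mulrC.
have tSym u v : u \in S -> v \in S -> tperm u v \in Sym S.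
  move=> Su Sv; rewrite inE; apply: subset_trans (tperm_on u v) _.
  by apply/subsetP=> w; rewrite !inE => /orP[]/eqP->.
have tR : tperm x y \in stab_in S r.
  by apply/stab_inP; split=> [|w]; [exact: tSym | case: tpermP => // ->].
have tC : tperm (g x) (g y) \in stab_in S c.
  apply/stab_inP; split=> [|w]; last by case: tpermP => // ->.
  by move: Sg; rewrite inE => Sg; rewrite tSym ?perm_closed.
have gt : (tperm x y * g = g * tperm (g x) (g y))%g.
  by rewrite -tpermJ conjgE !mulgA mulgV mul1g.
have odd_t : odd_perm (tperm (g x) (g y)) by rewrite odd_tperm (inj_eq perm_inj).
have antisym (u : {perm T} -> algC) : u (tperm x y * g)%g = u g ->
    u (g * tperm (g x) (g y))%g = - u g -> u g = 0.
  rewrite gt => -> /eqP; rewrite -subr_eq0 opprK -mulr2n mulrn_eq0 /= => /eqP //.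
rewrite (antisym z); first last; [by rewrite zC // odd_t expr1 mulN1r | exact: zR |].
rewrite (antisym (young S r c)) ?mulr0 //; first exact: young_Ml.
by rewrite young_Mr // odd_t expr1 mulN1r.
Qed.

End Tableaux.

(** * Characters of Young symmetrizers *)

Section YoungCharacters.

Variables (T : finType) (S : {set T}) (r c : T -> nat).
Hypotheses (rc_inj : injective_on S r c) (rc_just : left_justified S r c).

(** The left-hand side has the symmetries of [young_unique] as a function of x. *)
Lemma young_sandwich :
  {in Sym S &, forall z x, \sum_(y in Sym S) young S r c y * young S r c (z^-1 * y^-1 * x)%g
     = (\sum_(y in Sym S) young S r c y * young S r c (z^-1 * y^-1)%g) * young S r c x}.
Proof.
move=> z x Sz Sx.
rewrite (@young_unique _ S r c (fun x => \sum_(y in Sym S) young S r c y *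
  young S r c (z^-1 * y^-1 * x)%g)) //.
- by congr (_ * _); apply: eq_bigr => y _; rewrite mulg1.
- move=> p g /[dup] Rp /stab_inP[Sp _] Sg; rewrite (reindex_inj (mulgI p)).
  apply: eq_big => [y|y _]; first by rewrite groupMl.
  by rewrite young_Ml // invMg !mulgA mulgKV.
- move=> g q Sg Cq; rewrite mulr_sumr; apply: eq_bigr => y _.
  by rewrite mulgA young_Mr // mulrCA.
Qed.

(** For the diagram of a partition, the product of the hook lengths. *)
Definition hook_const : algC := \sum_(y in Sym S) young S r c y * young S r c y^-1%g.

Lemma young_quasi_idem : quasi_idem (Sym_group S) (young S r c) hook_const.
Proof.
move=> x Sx; have := young_sandwich (group1 _) Sx; rewrite invg1.
under eq_bigr do rewrite mul1g.
by move=> ->; congr (_ * _); apply: eq_bigr => y _; rewrite mul1g.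
Qed.

Definition young_char := ideal_char (Sym_group S) (young S r c).

Lemma young_char_norm : '[young_char] = 1.
Proof. exact: ideal_char_norm young_quasi_idem (young1 rc_inj) young_sandwich. Qed.

Lemma young_charE g : g \in Sym S ->
  young_char g = hook_const^-1 * \sum_(x in Sym S) young S r c (x * g^-1 * x^-1)%g.
Proof.
by apply: ideal_charE young_quasi_idem _; rewrite young1 // oner_eq0.
Qed.

Lemma young_rat g : young S r c g \in Crat.
Proof. by apply: rpred_sum => p _; apply: rpred_sum => q _; rewrite rpredX ?rpredN1. Qed.

(** The trace formula shows that the values are rational, and values of
characters are algebraic integers. *)
Lemma young_char_int g : young_char g \in Num.int.
Proof.
have [Sg|nSg] := boolP (g \in Sym S); last by rewrite cfun0.
apply: Cint_rat_Aint; last exact/Aint_char/cfRepr_char.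
rewrite young_charE // rpredM ?rpredV ?rpred_sum // => [y _|x _];
  by rewrite ?rpredM ?young_rat.
Qed.

End YoungCharacters.

(** * Removing the first row *)

Section Complement.

Variables (T : finType) (L : {set T}).

Lemma SymT : Sym [set: T] = [set: {perm T}].
Proof. apply/setP=> g; rewrite inE [RHS]inE; apply/subsetP=> x _; exact: in_setT. Qed.

Lemma SymC_commute s a : s \in Sym L -> a \in Sym (~: L) -> (s * a = a * s)%g.
Proof.
rewrite !inE => Ls La; apply: perm_onC Ls La _.
by rewrite -setI_eq0 setICr.
Qed.

Lemma SymC_meet s a : s \in Sym L -> a \in Sym (~: L) -> (s * a = 1)%g -> s = 1%g /\ a = 1%g.
Proof.
move=> Ls La sa1; have def_s : s = a^-1%g by rewrite -(mulgK a s) sa1 mul1g.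
suff s1 : s = 1%g by split=> //; rewrite -[a]invgK -def_s s1 invg1.
apply/permP=> x; rewrite perm1; have [Lx|nLx] := boolP (x \in L).
  rewrite def_s; have : a^-1%g \in Sym (~: L) by rewrite groupV.
  by rewrite inE => /out_perm->; rewrite // inE Lx.
by move: Ls; rewrite inE => /out_perm->.
Qed.

Lemma sum_TI_group (V : nmodType) (gT : finGroupType) (A B C : {group gT}) (F : gT -> V) :
    A \subset C -> B \subset C -> A :&: B = 1%g ->
    {in C, forall x, exists2 a, a \in A & (a^-1 * x)%g \in B} ->
  \sum_(x in C) F x = \sum_(a in A) \sum_(b in B) F (a * b)%g.
Proof.
move=> sAC sBC tiAB CAB.
have -> : (C : {set gT}) = [set (u.1 * u.2)%g | u in setX A B].
  apply/setP=> x; apply/idP/imsetP => [/CAB[a Aa Bx]|[[a b]]].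
    exists (a, (a^-1 * x)%g); first by rewrite in_setX /= Aa Bx.
    by rewrite /= mulKVg.
  by rewrite in_setX => /andP[/= Aa Bb] ->; exact: groupM (subsetP sAC a Aa) (subsetP sBC b Bb).
rewrite big_imset /=; last first.
  case=> a b [a' b']; rewrite !in_setX /= => /andP[Aa Bb] /andP[Aa' Bb'] eq_ab.
  have : (a'^-1 * a)%g \in A :&: B.
    rewrite inE groupM ?groupV //=.
    have -> : (a'^-1 * a = b' * b^-1)%g.
      by apply: (mulgI a'); rewrite mulKVg mulgA -eq_ab mulgK.
    by rewrite groupM ?groupV.
  rewrite tiAB => /set1P/eqP; rewrite -eq_mulVg1 => /eqP def_a.
  by move: eq_ab; rewrite def_a => /mulgI->.
rewrite pair_big_dep; apply: eq_big => [[a b]|[a b] _] //=; exact: in_setX.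
Qed.

Lemma setwise_split (g : {perm T}) : (forall x, (g x \in L) = (x \in L)) ->
  exists2 a, a \in Sym (~: L) & (a^-1 * g)%g \in Sym L.
Proof.
move=> gL.
have nLg : g \in 'N(~: L | 'P).
  apply/setIP; split; first exact: in_setT.
  by rewrite inE; apply/subsetP=> x; rewrite !inE /= apermE gL.
set a := restr_perm (~: L) g.
have La : a \in Sym (~: L) by rewrite inE restr_perm_on.
exists a => //; rewrite inE; apply/subsetP=> x; rewrite inE; apply: contraR => nLx.
rewrite permM -(restr_permE nLg) -/a ?permKV //.
by move: (groupVr La); rewrite inE => /perm_closed->; rewrite inE.
Qed.

Lemma SymC_fix a x : a \in Sym (~: L) -> x \in L -> a x = x.
Proof. by rewrite inE => /out_perm fix_a Lx; apply: fix_a; rewrite inE Lx. Qed.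

Lemma SymC_mem a x : a \in Sym (~: L) -> (a x \in L) = (x \in L).
Proof. by rewrite inE => /(perm_closed x); rewrite !inE => /negb_inj. Qed.

(** The Young subgroup Sym L x Sym (~: L), described by what it preserves. *)
Definition setwise_stab := stab_in setT (fun x => nat_of_bool (x \in L)).

Lemma setwise_stabP (g : {perm T}) :
  reflect (forall x, (g x \in L) = (x \in L)) (g \in setwise_stab).
Proof.
apply: (iffP (stab_inP _ _ _)) => [[_ gL] x|gL]; last by rewrite SymT inE; split=> // x; rewrite gL.
by have := gL x; case: (_ \in _); case: (_ \in _).
Qed.

Lemma sum_setwise_stab (V : nmodType) (F : {perm T} -> V) :
  \sum_(g in setwise_stab) F g =
  \sum_(s in Sym L) \sum_(a in Sym (~: L)) F (s * a)%g.
Proof.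
rewrite [RHS]exchange_big /=.
transitivity (\sum_(a in Sym (~: L)) \sum_(s in Sym L) F (a * s)%g); last first.
  by apply: eq_bigr => a La; apply: eq_bigr => s Ls; rewrite (SymC_commute Ls La).
apply: (@sum_TI_group _ _ (Sym_group (~: L)) (Sym_group L)
  (stab_in_group setT (fun x => nat_of_bool (x \in L)))).
- by apply/subsetP=> a La; apply/setwise_stabP=> x; rewrite SymC_mem.
- by apply/subsetP=> s Ls; apply/setwise_stabP=> x; move: Ls; rewrite inE => /perm_closed->.
- apply/trivgP/subsetP=> a /setIP[La Ls]; rewrite inE.
  have := SymC_meet Ls (groupVr La); rewrite mulgV => /(_ erefl)[-> _].
  exact: eqxx.
by move=> g /setwise_stabP; apply: setwise_split.
Qed.

Lemma card_setwise_stab : #|setwise_stab| = (#|Sym L| * #|Sym (~: L)|)%N.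
Proof.
rewrite -sum1_card (sum_setwise_stab (fun=> 1%N)) /=.
by under eq_bigr do rewrite sum1_card; rewrite sum_nat_const.
Qed.

End Complement.

Section FirstRow.

Variables (T : finType) (r c : T -> nat).
Let L := [set x | 0 < r x]%N.
Hypotheses (rc_inj : injective_on setT r c) (rc_just : left_justified setT r c).

Lemma SymGT : Sym_group [set: T] = [set: {perm T}]%G.
Proof. exact/val_inj/SymT. Qed.

Definition full_char : 'CF([set: {perm T}]) := ideal_char [set: {perm T}]%G (young setT r c).

Lemma full_quasi_idem :
  quasi_idem [set: {perm T}]%G (young setT r c) (hook_const setT r c).
Proof. by rewrite -SymGT; apply: young_quasi_idem. Qed.

Lemma full_char_norm : '[full_char] = 1.
Proof.
have := young_char_norm rc_inj rc_just; rewrite /full_char /young_char.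
by move: (Sym_group _) SymGT => K ->.
Qed.

Lemma full_char_int g : full_char g \in Num.int.
Proof.
have := young_char_int rc_inj rc_just g; rewrite /full_char /young_char.
by move: (Sym_group _) SymGT => K ->.
Qed.

Lemma lower_inj : injective_on L r c.
Proof. by move=> x y _ _; apply: rc_inj; rewrite inE. Qed.

Lemma lower_just : left_justified L r c.
Proof.
move=> x j Lx lt_j; have [|y _ [ry cy]] := rc_just _ lt_j; first by rewrite inE.
by exists y => //; move: Lx; rewrite !inE ry.
Qed.

(** The ideal generated by this element affords the character induced from the
product of the character of L and the trivial character of Sym (~: L). *)
Definition lower_young (g : {perm T}) : algC :=
  \sum_(s in Sym L) \sum_(a in Sym (~: L)) (g == s * a)%g%:R * young L r c s.

Lemma sum_lower_young (F : {perm T} -> algC) :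
  \sum_g lower_young g * F g =
  \sum_(s in Sym L) \sum_(a in Sym (~: L)) young L r c s * F (s * a)%g.
Proof.
under eq_bigr do rewrite mulr_suml.
rewrite exchange_big; apply: eq_bigr => s Ls.
under eq_bigr do rewrite mulr_suml.
rewrite exchange_big; apply: eq_bigr => a La.
rewrite (bigD1 (s * a)%g) //= eqxx mul1r big1 ?addr0 // => g ng.
by rewrite (negbTE ng) !mul0r.
Qed.

Lemma lower_young1 : lower_young 1%g = 1.
Proof.
rewrite /lower_young (bigD1 1%g) ?group1 //= (bigD1 1%g) ?group1 //= mulg1 eqxx mul1r.
rewrite young1; last exact: lower_inj.
rewrite big1 ?addr0 => [|a /andP[La na1]]; last by rewrite mul1g eq_sym (negbTE na1) mul0r.
rewrite big1 ?addr0 // => s /andP[Ls ns1]; apply: big1 => a La.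
case: eqP => [/esym sa1|]; last by rewrite mul0r.
by case/eqP: ns1; case: (SymC_meet Ls La sa1).
Qed.

Definition lower_const : algC := #|Sym (~: L)|%:R * hook_const L r c.

Lemma lower_quasi_idem : quasi_idem [set: {perm T}]%G lower_young lower_const.
Proof.
move=> x _; rewrite (eq_bigl xpredT) => [|y]; last by rewrite inE.
rewrite sum_lower_young /lower_const -mulrA.
transitivity (\sum_(a in Sym (~: L)) hook_const L r c * lower_young x); last first.
  by rewrite sumr_const mulr_natl.
rewrite exchange_big; apply: eq_bigr => a La /=.
transitivity (\sum_(s in Sym L) \sum_(b in Sym (~: L)) \sum_(t in Sym L)
   (x == t * b)%g%:R * (young L r c s * young L r c (s^-1 * t)%g)); last first.
  rewrite /lower_young [RHS]mulr_sumr; under [RHS]eq_bigr do rewrite mulr_sumr.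
  rewrite exchange_big [RHS]exchange_big /=; apply: eq_bigr => b Lb.
  rewrite exchange_big /=; apply: eq_bigr => t Lt.
  rewrite -mulr_sumr [RHS]mulrCA; congr (_ * _).
  exact: (young_quasi_idem lower_inj lower_just Lt).
apply: eq_bigr => s Ls; rewrite /lower_young exchange_big mulr_sumr /=.
rewrite [RHS](reindex_inj (mulgI a)) /=; apply: eq_big => [b|b Lb]; first by rewrite groupMl.
rewrite mulr_sumr [RHS](reindex_inj (mulgI s)) /=; apply: eq_big => [t|t Lt]; first by rewrite groupMl.
rewrite mulrCA mulKg; congr (_%:R * _).
rewrite -(inj_eq (mulgI (s * a)%g)) mulKVg -!mulgA; congr (nat_of_bool (x == s * _)%g).
by rewrite !mulgA (SymC_commute Lt La).
Qed.

Lemma row_stab_split (F : {perm T} -> algC) :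
  \sum_(p in stab_in setT r) F p =
  \sum_(a in Sym (~: L)) \sum_(p in stab_in L r) F (a * p)%g.
Proof.
apply: (@sum_TI_group _ _ (Sym_group (~: L)) (stab_in_group L r) (stab_in_group setT r)).
- apply/subsetP=> a La; apply/stab_inP; split=> [|x]; first by rewrite SymT inE.
  have [Lx|nLx] := boolP (x \in L).
    by move: La; rewrite inE => /out_perm->; rewrite // inE Lx.
  have : a x \notin L by move: La nLx; rewrite inE -!in_setC => /perm_closed->.
  by move: nLx; rewrite !inE -!leqNgt !leqn0 => /eqP-> /eqP.
- apply/subsetP=> p /stab_inP[_ rp]; apply/stab_inP; split=> //; first by rewrite SymT inE.
- apply/trivgP/subsetP=> a /setIP[La /stab_inP[Ls _]]; rewrite inE.
  have := SymC_meet Ls (groupVr La); rewrite mulgV => /(_ erefl)[-> _].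
  exact: eqxx.
move=> p /stab_inP[_ rp].
have pL x : (p x \in L) = (x \in L) by rewrite !inE rp.
have [a La Lap] := setwise_split pL; exists a => //.
apply/stab_inP; split=> // x; rewrite permM.
have [Lx|nLx] := boolP (x \in L); first by rewrite (SymC_fix (groupVr La) Lx) rp.
have nLax : (a^-1)%g x \notin L by rewrite (SymC_mem _ (groupVr La)).
have : p ((a^-1)%g x) \notin L by rewrite pL.
by move: nLx nLax; rewrite !inE -!leqNgt !leqn0 => /eqP-> _ /eqP.
Qed.

Lemma youngE S g : young S r c g =
  \sum_(p in stab_in S r) ((p^-1 * g)%g \in stab_in S c)%:R * (-1) ^+ odd_perm (p^-1 * g)%g.
Proof.
apply: eq_bigr => p _; have [Cpg|nCpg] := boolP (_ \in _).
  rewrite mul1r (big_pred1 (p^-1 * g)%g) // => q /=.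
  rewrite -[in RHS](inj_eq (mulgI p)) mulKVg andb_idl // => /eqP def_g.
  by rewrite -def_g mulKg in Cpg.
rewrite mul0r big_pred0 // => q; apply: contraNF nCpg => /andP[Cq /eqP<-].
by rewrite mulKg.
Qed.

(** The row stabilizer is the product of Sym (~: L) and of the row stabilizer
of L, and the signed sum over the column stabilizer absorbs, up to its order,
the signed sum over the column stabilizer of L. *)
Lemma young_lowerE g : young setT r c g = \sum_h lower_young h *
  (#|stab_in L c|%:R^-1 * ((h^-1 * g)%g \in stab_in setT c)%:R * (-1) ^+ odd_perm (h^-1 * g)%g).
Proof.
rewrite sum_lower_young youngE row_stab_split [RHS]exchange_big /=.
apply: eq_bigr => a La.
transitivity (\sum_(p in stab_in L r) \sum_(q in stab_in L c) (-1) ^+ odd_perm q *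
  (#|stab_in L c|%:R^-1 * (((a * (p * q))^-1 * g)%g \in stab_in setT c)%:R *
    (-1) ^+ odd_perm ((a * (p * q))^-1 * g)%g) : algC).
  have nzC : (#|stab_in L c|%:R : algC) != 0 by rewrite pnatr_eq0 -lt0n cardG_gt0.
  apply: eq_bigr => p Rp.
  transitivity (\sum_(q in stab_in L c) #|stab_in L c|%:R^-1 * (((a * p)^-1 * g)%g \in stab_in setT c)%:R *
    (-1) ^+ odd_perm ((a * p)^-1 * g)%g : algC).
    by rewrite sumr_const -[RHS]mulr_natl -!mulrA mulVKf.
  apply: eq_bigr => q Cq.
  have Cq' : q \in stab_in setT c.
    by case/stab_inP: Cq => _ cq; apply/stab_inP; rewrite SymT inE.
  rewrite (mulgA a p q) (invMg (a * p)%g q) -(mulgA q^-1%g).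
  rewrite (@groupMl _ (stab_in_group setT c) q^-1%g) ?groupV //.
  by rewrite (odd_permM q^-1%g) odd_permV signr_addb [RHS]mulrCA signrMK.
rewrite /young.
under [RHS]eq_bigr do rewrite mulr_suml.
rewrite [RHS]exchange_big; apply: eq_bigr => p Rp.
under [RHS]eq_bigr do rewrite mulr_suml.
rewrite (exchange_big_dep (mem (stab_in L c))) /= => [|s q _ /andP[]//].
apply: eq_bigr => q Cq; rewrite (big_pred1 (p * q)%g) => [|s].
  rewrite (SymC_commute _ La) // groupM //.
    by case/stab_inP: Rp.
  by case/stab_inP: Cq.
rewrite /= Cq /= eq_sym andb_idl // => /eqP->; rewrite groupM //.
  by case/stab_inP: Rp.
by case/stab_inP: Cq.
Qed.

Lemma lower_char_sub : ideal_char [set: {perm T}]%G lower_young - full_char \is a character.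
Proof.
apply: (@ideal_char_sub _ _ _ _ (fun q => #|stab_in L c|%:R^-1 *
  (q \in stab_in setT c)%:R * (-1) ^+ odd_perm q)) => g _.
rewrite young_lowerE; apply: eq_bigl => h.
by rewrite inE.
Qed.

(** Frobenius reciprocity, read off the trace formula: conjugating by Sym L turns
the coefficients of the Young symmetrizer into character values. *)
Lemma lower_char_cfdot (phi : 'CF([set: {perm T}])) :
  '[ideal_char [set: {perm T}]%G lower_young * phi, 1] =
  (#|Sym L| * #|Sym (~: L)|)%:R^-1 *
  \sum_(s in Sym L) \sum_(a in Sym (~: L)) young_char L r c s * phi (s * a)%g.
Proof.
have nz1 : lower_young 1%g != 0 by rewrite lower_young1 oner_eq0.
have nzT : (#|[set: {perm T}]|%:R : algC) != 0 by rewrite pnatr_eq0 -lt0n (cardG_gt0 [set: {perm T}]%G).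
have nzL : (#|Sym L|%:R : algC) != 0 by rewrite pnatr_eq0 -lt0n (cardG_gt0 (Sym_group L)).
transitivity (lower_const^-1 * \sum_g lower_young g * phi g^-1%g).
  rewrite cfdotE.
  transitivity (#|[set: {perm T}]|%:R^-1 * \sum_(x in [set: {perm T}]) lower_const^-1 * \sum_g lower_young g * phi g^-1%g).
    congr (_ * _).
    transitivity (\sum_(g in [set: {perm T}]) \sum_(x in [set: {perm T}]) lower_const^-1 *
      (lower_young (x * g^-1 * x^-1)%g * phi g)).
      apply: eq_bigr => g Gg; rewrite cfunE cfun1E Gg conjC1 mulr1.
      rewrite (ideal_charE lower_quasi_idem) // -mulrA mulr_suml mulr_sumr.
      by apply: eq_bigr.
    rewrite exchange_big; apply: eq_bigr => x _; rewrite -mulr_sumr; congr (_ * _).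
    rewrite [LHS](reindex_inj (inj_comp (conjg_inj x) invg_inj)) /=.
    apply: eq_big => [g|g _]; first by rewrite !inE.
    rewrite -conjVg invgK conjgE -!mulgA mulgV mulg1 mulKVg; congr (_ * _).
    by rewrite cfunJ ?inE.
  by rewrite sumr_const -[X in _ * X]mulr_natl mulKf.
rewrite sum_lower_young; symmetry.
transitivity ((#|Sym L| * #|Sym (~: L)|)%:R^-1 * \sum_(s in Sym L) \sum_(a in Sym (~: L))
   \sum_(x in Sym L) (hook_const L r c)^-1 * (young L r c (x * s^-1 * x^-1)%g * phi (s * a)%g)).
  congr (_ * _); apply: eq_bigr => s Ls; apply: eq_bigr => a La.
  rewrite (young_charE lower_inj lower_just Ls) -mulrA mulr_suml mulr_sumr.
  by [].
transitivity ((#|Sym L| * #|Sym (~: L)|)%:R^-1 * \sum_(x in Sym L) (hook_const L r c)^-1 *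
    \sum_(s in Sym L) \sum_(a in Sym (~: L)) young L r c s * phi (s * a)^-1%g).
  congr (_ * _).
  under eq_bigr do rewrite exchange_big /=.
  rewrite exchange_big; apply: eq_bigr => x Lx.
  rewrite mulr_sumr [LHS](reindex_inj (inj_comp (conjg_inj x) invg_inj)) /=.
  apply: eq_big => [s|s Ls]; first by rewrite memJ_norm ?groupV // (subsetP (normG (Sym_group L))).
  have Ls' : s \in Sym L by move: Ls; rewrite /= memJ_norm ?groupV // (subsetP (normG (Sym_group L))).
  rewrite mulr_sumr [LHS](reindex_inj invg_inj) /=; apply: eq_big => [a|a La]; first by rewrite groupV.
  have La' : a \in Sym (~: L) by move: La; rewrite groupV.
  rewrite -conjVg invgK conjgE -!mulgA mulgV mulg1 mulKVg; congr (_ * (_ * _)).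
  rewrite (SymC_commute Ls' La') invMg (SymC_commute Lx (groupVr La')).
  by rewrite -[RHS](@cfunJ _ _ phi _ x) ?inE // conjgE !mulgA.
rewrite sumr_const -[X in _ * X]mulr_natl natrM invfM /lower_const invfM -!mulrA.
by rewrite mulrCA mulKf // mulrCA.
Qed.

Lemma multiplicity_le (phi : 'CF([set: {perm T}])) : phi \is a character ->
  '[full_char * phi, 1] <= (#|Sym L| * #|Sym (~: L)|)%:R^-1 *
  \sum_(s in Sym L) \sum_(a in Sym (~: L)) young_char L r c s * phi (s * a)%g.
Proof.
move=> char_phi; rewrite -lower_char_cfdot -subr_ge0 -cfdotBl -mulrBl.
apply: natr_ge0; apply: Cnat_cfdot_char; rewrite ?cfun1_char //.
by rewrite rpredM // lower_char_sub.
Qed.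

End FirstRow.

(** * Dimensions after removing the first row *)

Section Dimension.

Variables (T : finType) (r c : T -> nat).
Let L := [set x | 0 < r x]%N.
Hypothesis rc_inj : injective_on setT r c.

Let U := [set x | (r x == 0)%N && [exists y in L, c y == c x]].

Let LP x : (x \in L) = (r x != 0%N).
Proof. by rewrite inE lt0n. Qed.

Lemma first_row_col_inj x y : x \notin L -> y \notin L -> c x = c y -> x = y.
Proof.
by rewrite !LP !negbK => /eqP rx /eqP ry; apply: rc_inj; rewrite ?inE ?rx ?ry.
Qed.

(** A column that meets L has only one cell in the first row. *)
Lemma card_covered : (#|U| <= #|L|)%N.
Proof.
pose f x := odflt x [pick y in L | c y == c x].
have fP x : x \in U -> f x \in L /\ c (f x) = c x.
  rewrite inE => /andP[_ /exists_inP[y Ly cy]]; rewrite /f.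
  by case: pickP => [z /andP[Lz /eqP cz]|/(_ y)] //=; rewrite Ly cy.
have f_inj : {in U &, injective f}.
  move=> x y Ux Uy fxy; apply: first_row_col_inj.
  - by move: Ux; rewrite LP inE => /andP[->].
  - by move: Uy; rewrite LP inE => /andP[->].
  - by rewrite -(fP x Ux).2 fxy (fP y Uy).2.
rewrite -(card_in_imset f_inj); apply/subset_leq_card/subsetP => _ /imsetP[x Ux ->].
by case: (fP x Ux).
Qed.

(** If g = p q with p in the row stabilizer and q in the column stabilizer, then
p preserves L, and q sends a cell of L to another cell of its column, which
lies either in L or in U. *)
Lemma young_off_cover g (x : T) : young setT r c g != 0 ->
  (forall x, x \in L -> g x \notin U) -> (g x \in L) = (x \in L).
Proof.
rewrite youngE => nz0 gU.
have [p Rp Cq] : exists2 p, p \in stab_in setT r & (p^-1 * g)%g \in stab_in setT c.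
  apply/exists_inP; apply: contraNT nz0; rewrite negb_exists => /forallP Cg.
  rewrite big1 // => p Rp; have := Cg p; rewrite Rp /= => /negbTE->.
  by rewrite mul0r.
have pL y : (p y \in L) = (y \in L) by case/stab_inP: Rp => _ rp; rewrite !LP rp.
case/stab_inP: Cq => _ cq.
have gE y : g y = (p^-1 * g)%g (p y) by rewrite permM permK.
have gL y : y \in L -> g y \in L.
  move=> Ly; rewrite LP; apply: contra (gU y Ly) => rgy; rewrite inE rgy /=.
  by apply/exists_inP; exists (p y); rewrite ?pL // gE cq.
have /setP/(_ (g x)) : g @: L = L.
  apply/eqP; rewrite eqEcard card_imset ?leqnn ?andbT; last exact: perm_inj.
  by apply/subsetP=> _ /imsetP[y Ly ->]; apply: gL.
by rewrite (mem_imset _ _ (@perm_inj _ g)) => ->.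
Qed.

Lemma young_lower g : g \in Sym L -> young setT r c g = young L r c g.
Proof.
move=> Lg; rewrite !youngE [RHS]big_mkcond [LHS]big_mkcond; apply: eq_bigr => p _ /=.
have gN x : x \notin L -> g x = x by move: Lg; rewrite inE => /out_perm; apply.
have [/stab_inP[Lp rp]|nLp] := boolP (p \in stab_in L r).
  have -> : p \in stab_in setT r by apply/stab_inP; rewrite SymT inE.
  congr ((nat_of_bool _)%:R * _); apply/stab_inP/stab_inP => -[_ cq]; split=> //.
    by rewrite groupM ?groupV.
  by rewrite SymT inE.
case: ifP => // /stab_inP[_ rp]; case: (boolP (_ \in _)) => [/stab_inP[_ cq]|]; last by rewrite mul0r.
have pL x : (p x \in L) = (x \in L) by rewrite !LP rp.
case/negP: nLp; apply/stab_inP; split=> //; rewrite inE; apply/subsetP=> x; rewrite inE.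
apply: contraR => nLx; apply/eqP/first_row_col_inj => //; rewrite ?pL //.
by rewrite -(cq (p x)) permM permK gN.
Qed.

(** For every set A of #|L| cells outside U, choose a permutation xB A that fixes
U and sends L to A.  Restrict the matrix of the Young symmetrizer to the rows
and columns indexed by the products h * xB A with h in Sym L: by
[young_off_cover] the entries with different sets A vanish, and each diagonal
block is the matrix of the Young symmetrizer of L. *)
Lemma young_rank_lower :
  ('C(#|T| - #|U|, #|L|) * \rank (lmul_mx (Sym_group L) (young L r c))
    <= \rank (lmul_mx [set: {perm T}]%G (young setT r c)))%N.
Proof.
pose B := {A : {set T} | (A \subset ~: U) && (#|A| == #|L|)}.
have LU x : x \in L -> x \notin U by rewrite LP inE => /negbTE->.
have xP (A : B) : exists2 s, s \in Sym (~: U) & forall x, (x \in L) = (s x \in val A).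
  have /andP[/subsetP sAU /eqP cardA] := valP A.
  apply: (exists_perm_fiber (A := bool)) => [x|b].
    rewrite !in_setC negbK => Ux; apply/idP/idP => [/LU|/sAU]; last by rewrite in_setC Ux.
    by rewrite Ux.
  suff eqF (P Q : {set T}) : #|P| = #|Q| ->
     #|[set x | (x \in P) == b]| = #|[set x | (x \in Q) == b]| by apply: eqF.
  have setE (D : {set T}) : [set x | (x \in D) == b] = if b then D else ~: D.
    by apply/setP=> x; case: b; rewrite !inE /= ?eqb_id ?eqbF_neg.
  move=> eqPQ; rewrite !setE; case: b {setE} => //.
  by apply/eqP; rewrite -(eqn_add2l #|P|) cardsC eqPQ cardsC.
have [xB xBS xBL'] := fin_all_exists2 xP.
have xBL A x : (xB A x \in val A) = (x \in L) by rewrite -xBL'.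
(* Row (h, A) and column (h', A'). *)
have entry (A A' : B) h h' : h \in Sym L -> h' \in Sym L ->
    young setT r c ((h' * xB A') * (h * xB A)^-1)%g =
    if A == A' then young L r c (h' * h^-1)%g else 0.
  move=> Lh Lh'; case: eqP => [->|neqA].
    by rewrite invMg mulgA mulgK young_lower // groupM ?groupV.
  apply: contra_not_eq neqA => nz; apply: val_inj; apply/setP=> y /=.
  have hL x : (h x \in L) = (x \in L) by move: Lh; rewrite inE => /perm_closed->.
  have hL' x : (h' x \in L) = (x \in L) by move: Lh'; rewrite inE => /perm_closed->.
  have hU x : (h x \in U) = (x \in U).
    have [Lx|nLx] := boolP (x \in L); last by move: Lh; rewrite inE => /out_perm->.
    by rewrite !(negbTE (LU _ _)) ?hL.
  have xU x : (xB A x \in U) = (x \in U).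
    by have := xBS A; rewrite inE => /(perm_closed x); rewrite !in_setC => /negb_inj->.
  have gE x : xB A (h (((h' * xB A') * (h * xB A)^-1)%g x)) = xB A' (h' x).
    by rewrite -!permM mulgKV.
  have gU x : x \in L -> ((h' * xB A') * (h * xB A)^-1)%g x \notin U.
    move=> Lx; rewrite -hU -xU gE; have /andP[/subsetP sAU _] := valP A'.
    by rewrite -in_setC; apply: sAU; rewrite xBL hL'.
  have := young_off_cover _ nz gU; set g := (_ * _)%g in gE * => gL.
  pose x := (h' * xB A')^-1%g y.
  have -> : y = xB A' (h' x) by rewrite -permM permKV.
  by rewrite xBL hL' -gE xBL hL gL.
set M := lmul_mx _ _; set N := lmul_mx _ _.
have inG x : x \in [set: {perm T}] by rewrite inE.
pose ix (j : 'I_#|Sym_group L|) (A : B) := gring_index [set: {perm T}]%G (enum_val j * xB A)%g.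
have ME j A j' A' : N (ix j A) (ix j' A') = if A == A' then M j j' else 0.
  rewrite !mxE !gring_indexK ?inG // entry ?enum_valP //.
(* Compressing both sides by A1 and A2 turns the diagonal blocks into
   identity matrices, hence the whole submatrix into an identity matrix. *)
pose A1 := pinvmx (col_base M); pose A2 := pinvmx (row_base M).
have A1MA2 : A1 *m M *m A2 = 1%:M.
  have A1C : A1 *m col_base M = 1%:M := mulVpmx (col_base_full M).
  have -> : A1 *m M = row_base M by rewrite -[RHS]mul1mx -A1C -mulmxA mulmx_base.
  exact: mulmxVp (row_base_free M).
pose J : finType := ('I_(\rank M) * B)%type.
pose Z := \matrix_(k < #|J|, z < #|[set: {perm T}]|)
  \sum_i A1 (enum_val k).1 i * N (ix i (enum_val k).2) z.
pose W := \matrix_(k < #|J|, k' < #|J|)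
  \sum_j Z k (ix j (enum_val k').2) * A2 j (enum_val k').1.
have ZN : (\rank Z <= \rank N)%N.
  apply: mxrankS; apply/row_subP=> k.
  have -> : row k Z = \sum_i A1 (enum_val k).1 i *: row (ix i (enum_val k).2) N.
    by apply/rowP=> z; rewrite !mxE summxE; apply: eq_bigr => i _; rewrite !mxE.
  by apply: summx_sub => i _; rewrite scalemx_sub // row_sub.
have WZ : (\rank W <= \rank Z)%N.
  rewrite -[\rank W]mxrank_tr -[\rank Z]mxrank_tr.
  apply: mxrankS; apply/row_subP=> k.
  have -> : row k W^T = \sum_i A2 i (enum_val k).1 *: row (ix i (enum_val k).2) Z^T.
    by apply/rowP=> z; rewrite !mxE summxE; apply: eq_bigr => i _; rewrite !mxE mulrC.
  by apply: summx_sub => i _; rewrite scalemx_sub // row_sub.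
apply: leq_trans (leq_trans WZ ZN).
have -> : W = 1%:M.
  apply/matrixP=> k k'; rewrite !mxE.
  transitivity (if (enum_val k).2 == (enum_val k').2 then
     (A1 *m M *m A2) (enum_val k).1 (enum_val k').1 else 0).
    case: eqP => [eqA|neqA].
      rewrite [RHS]mxE; apply: eq_bigr => j _; congr (_ * _); rewrite !mxE.
      by apply: eq_bigr => i _; rewrite ME eqA eqxx.
    rewrite big1 // => j _; rewrite mxE big1 ?mul0r // => i _.
    by rewrite ME (introF eqP neqA) mulr0.
  rewrite A1MA2 mxE -(inj_eq enum_val_inj).
  case: (enum_val k) (enum_val k') => [i A] [i' A'] /=.
  by rewrite -pair_eqE /= andbC; case: (A == A'); rewrite //= mulr0n.
rewrite mxrank1 card_prod card_ord mulnC leq_mul2l; apply/orP; right.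
rewrite card_sig -(cardsC U) addKn -cards_draws.
by apply: subset_leq_card; apply/subsetP=> A; rewrite !inE.
Qed.

End Dimension.

(** * Moments of the number of small invariant sets *)

Section InvariantSets.

Variables (R : realType) (T : finType) (S : {set T}).

Definition small_invariant D (a : {perm T}) :=
  #|[set A : {set T} | [&& A \subset S, a @: A == A & (#|A| <= D)%N]]|.

Section Colours.

Variable P : nat.
Implicit Types (w : {ffun 'I_P -> {set T}}) (a g : {perm T}).

(** A tuple of P subsets amounts to a colouring of the points by subsets of the
set of indices. *)
Definition colour w y : {set 'I_P} := [set i | y \in w i].
Definition supported w := [forall i, w i \subset S].
Definition move w a : {ffun 'I_P -> {set T}} := [ffun i => a @: w i].
(** The number of points of colour set0 is determined by the others; leaving it
out, where all points have weight 1, is what keeps the sum of the weights of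
all profiles bounded independently of the number of points. *)
Definition profile w : {ffun {set 'I_P} -> 'I_#|T|.+1} :=
  [ffun J => if J == set0 then ord0 else inord #|[set y | colour w y == J]|].

Lemma profileE w J : J != set0 -> profile w J = #|[set y | colour w y == J]| :> nat.
Proof. by move=> nzJ; rewrite ffunE (negbTE nzJ) inordK // ltnS max_card. Qed.

Lemma moveM w a g : move w (a * g)%g = move (move w a) g.
Proof.
apply/ffunP=> i; rewrite !ffunE -imset_comp; apply: eq_imset => x.
by rewrite permM.
Qed.

Lemma supported_colour w y : supported w -> y \notin S -> colour w y = set0.
Proof.
move=> /forallP wS nSy; apply/setP=> i; rewrite !inE; apply: contraNF nSy.
exact/subsetP.
Qed.

Lemma same_profile w1 w2 : supported w1 -> supported w2 -> profile w1 = profile w2 ->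
  exists2 g, g \in Sym S & move w1 g = w2.
Proof.
move=> S1 S2 eq12.
have eqJ J : J != set0 -> #|[set y | colour w1 y == J]| = #|[set y | colour w2 y == J]|.
  by move=> nzJ; rewrite -!profileE // eq12.
have part w : (#|T| = #|[set y | colour w y == set0]| +
    \sum_(J : {set 'I_P} | J != set0) #|[set y | colour w y == J]|)%N.
  rewrite -[LHS]sum1_card [LHS](partition_big (colour w) xpredT) //= [LHS](bigD1 set0) //=.
  by congr (_ + _)%N; [|apply: eq_bigr => J _]; rewrite -sum1_card; apply: eq_bigl => y; rewrite inE.
have [x|J|g Sg g12] := @exists_perm_fiber T _ S (colour w1) (colour w2).
- by rewrite in_setC => nSx; rewrite !supported_colour.
- have [->|] := eqVneq J set0; last exact: eqJ.
  apply/eqP; rewrite -(eqn_add2r (\sum_(J : {set 'I_P} | J != set0) #|[set y | colour w1 y == J]|)).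
  by rewrite -part (eq_bigr _ eqJ) -part.
exists g => //; apply/ffunP=> i; rewrite ffunE; apply/setP=> y.
rewrite -[y](permKV g) mem_imset; last exact: perm_inj.
by have /setP/(_ i) := g12 (g^-1 y)%g; rewrite !inE.
Qed.

(** Supported tuples with the same profile form a single orbit of Sym S.  Multiplying the
stabilizer of w by a permutation that sends a fixed w1 to w gives permutations
sending w1 to w, and these sets are disjoint as w varies. *)
Lemma sum_stab_profile w0 :
  (\sum_(w | supported w && (profile w == profile w0)) #|[set a in Sym S | move w a == w]|
    <= #|S|`!)%N.
Proof.
have [w1 /andP[S1 /eqP p1]|no_w] := pickP (fun w => supported w && (profile w == profile w0));
  last by rewrite big_pred0.
rewrite -perm.card_Sym -sum1_card (partition_big (move w1) xpredT) //=.
rewrite [X in (_ <= X)%N](bigID (fun w => supported w && (profile w == profile w0))) /=.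
apply: leq_trans (leq_addr _ _); apply: leq_sum => w /andP[Sw /eqP pw].
have [g Sg gw] := same_profile S1 Sw (etrans p1 (esym pw)).
rewrite sum1_card -(card_imset _ (mulgI g)); apply: subset_leq_card.
apply/subsetP=> _ /imsetP[a /setIdP[Sa /eqP aw] ->].
by rewrite unfold_in /= groupM //= moveM gw aw eqxx.
Qed.

Lemma weight_profile (x : R) w : supported w ->
  \prod_i x ^+ #|w i| = \prod_(J : {set 'I_P}) x ^+ (#|J| * profile w J).
Proof.
move=> Sw; rewrite -!expr_sum; congr (x ^+ _).
transitivity (\sum_y #|colour w y|)%N; last first.
  rewrite (partition_big (colour w) xpredT) //=; apply: eq_bigr => J _.
  rewrite (eq_bigr (fun=> #|J|)) => [|y /eqP-> //]; rewrite sum_nat_cond_const.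
  have [->|nzJ] := eqVneq J set0; first by rewrite cards0 muln0 mul0n.
  by rewrite profileE // mulnC cardsE.
under eq_bigr do rewrite -sum1_card big_mkcond.
rewrite exchange_big; apply: eq_bigr => y _ /=.
by rewrite -big_mkcond -sum1_card; apply: eq_bigl => i; rewrite inE.
Qed.

End Colours.

Lemma geometric_le (y : R) n : 0 <= y <= 2^-1 -> \sum_(j < n) y ^+ j <= expR (2 * y).
Proof.
move=> /andP[y0 y1]; apply: le_trans (expR_ge1Dx _).
have y_lt1 : y < 1 by apply: le_lt_trans y1 _; rewrite invf_lt1 // ltr1n.
rewrite -(ler_pM2l (x := 1 - y)) ?subr_gt0 //.
have := subrX1 y n; rewrite -[y ^+ n - 1]opprB -[y - 1]opprB mulNr => /oppr_inj <-.
have yn : 0 <= y ^+ n by rewrite exprn_ge0.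
nra.
Qed.

Lemma sum_set_expr (x : R) P : \sum_(J : {set 'I_P}) x ^+ #|J| = (1 + x) ^+ P.
Proof.
rewrite -[P in RHS]card_ord -prodr_const.
rewrite [RHS](eq_bigr (fun=> x + 1)) => [|i _]; last by rewrite addrC.
rewrite [RHS]bigA_distr; apply: eq_bigr => J _.
by rewrite -big_mkcond /= prodr_const.
Qed.

(** Weight a subset A by x ^ #|A|, which is at least x ^ D for the subsets that
are counted.  The P-th power is then a weighted count of invariant P-tuples;
exchanging the sums makes it a weighted count of profiles, and the sum over
all profiles factors into one geometric series per nonempty colour. *)
Lemma moment_small_invariant (x : R) (P D : nat) : 0 < x <= 2^-1 ->
  \sum_(a in Sym S) (small_invariant D a)%:R ^+ P <=
  #|S|`!%:R * x ^- (D * P) * expR (2 * (1 + x) ^+ P).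
Proof.
move=> /andP[x0 x1].
have x_ge0 := ltW x0.
have x_le1 : x <= 1 by apply: le_trans x1 _; rewrite invf_le1 // ler1n.
rewrite mulrAC ler_pdivlMr ?exprn_gt0 // mulr_suml.
pose Q a (A : {set T}) := (A \subset S) && (a @: A == A).
apply: (@le_trans _ _ (\sum_(a in Sym S) \sum_(w | supported w && (move w a == w))
    \prod_(i < P) x ^+ #|w i|)).
  apply: ler_sum => a _; rewrite exprM -exprMn.
  apply: (@le_trans _ _ (\prod_(i < P) \sum_(A | Q a A) x ^+ #|A|)).
    rewrite prodr_const card_ord lerXn2r ?nnegrE ?mulr_ge0 ?exprn_ge0 //.
      by apply: sumr_ge0 => A _; rewrite exprn_ge0.
    rewrite /small_invariant -sum1_card natr_sum mulr_suml.
    rewrite [X in _ <= X](bigID (fun A : {set T} => #|A| <= D)%N) /=.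
    rewrite -[X in X <= _]addr0 lerD //; last by apply: sumr_ge0 => A _; rewrite exprn_ge0.
    rewrite (eq_bigl (fun A => Q a A && (#|A| <= D)%N)) => [|A]; last by rewrite inE andbA.
    by apply: ler_sum => A /andP[_ le_AD]; rewrite mul1r ler_wiXn2l.
  rewrite bigA_distr_big le_eqVlt; apply/orP; left; apply/eqP.
  apply: eq_bigl => w; apply/ffun_onP/andP => [Qw|[/forallP Sw /eqP mw] i].
    split; first by apply/forallP=> i; case/andP: (Qw i).
    by apply/eqP/ffunP=> i; rewrite ffunE; case/andP: (Qw i) => _ /eqP.
  by rewrite unfold_in /Q Sw /=; apply/eqP; rewrite -{2}mw ffunE.
rewrite (exchange_big_dep (@supported P)) /= => [|a w _ /andP[]//].
apply: (@le_trans _ _ (\sum_(k : {ffun {set 'I_P} -> 'I_#|T|.+1} | k set0 == ord0)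
   #|S|`!%:R * \prod_(J : {set 'I_P}) x ^+ (#|J| * k J))).
  rewrite (partition_big (@profile P) (fun k => k set0 == ord0)) /=; last first.
    by move=> w _; rewrite ffunE eqxx.
  apply: ler_sum => k _.
  have [w0 /andP[S0 /eqP p0]|no_w] := pickP (fun w : {ffun 'I_P -> {set T}} => supported w && (profile w == k));
    last by rewrite big_pred0 // mulr_ge0 ?prodr_ge0 // => J _; rewrite exprn_ge0.
  have nw := sum_stab_profile w0; rewrite p0 -(ler_nat R) in nw.
  apply: le_trans (ler_wpM2r _ nw); last by apply: prodr_ge0 => J _; rewrite exprn_ge0.
  rewrite natr_sum mulr_suml le_eqVlt; apply/orP; left; apply/eqP.
  apply: eq_bigr => w /andP[Sw /eqP pw]; rewrite -pw -weight_profile //.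
  rewrite sumr_const -[LHS]mulr_natl; congr (_%:R * _).
  by apply: eq_card => a; rewrite [RHS]inE unfold_in /= Sw.
rewrite -mulr_sumr ler_wpM2l ?ler0n //.
(* For J = set0 only the count 0 is kept, as in the definition of profile. *)
pose F (J : {set 'I_P}) (j : 'I_#|T|.+1) := if J == set0 then (j == ord0)%:R else (x ^+ #|J|) ^+ j.
apply: (@le_trans _ _ (\prod_(J : {set 'I_P}) \sum_(j < #|T|.+1) F J j)).
  rewrite bigA_distr_bigA /= [X in _ <= X](bigID (fun k : {ffun {set 'I_P} -> 'I_#|T|.+1} => k set0 == ord0)) /=.
  rewrite -[X in X <= _]addr0 lerD //.
    rewrite le_eqVlt; apply/orP; left; apply/eqP; apply: eq_bigr => k /eqP k0.
    apply: eq_bigr => J _; rewrite /F; case: eqP => [->|_]; last by rewrite exprM.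
    by rewrite k0 cards0 mul0n expr0.
  apply: sumr_ge0 => k _; apply: prodr_ge0 => J _; rewrite /F; case: ifP => _ //.
  by rewrite !exprn_ge0.
apply: (@le_trans _ _ (\prod_(J : {set 'I_P}) expR (2 * x ^+ #|J|))).
  apply: ler_prod => J _; rewrite /F; have [->|nzJ] := eqVneq J set0.
    rewrite (bigD1 ord0) //= big1 => [|j /negbTE-> //]; rewrite addr0 ler01 /=.
    by rewrite cards0 expr0 mulr1 ltW // expR_gt1.
  rewrite sumr_ge0 => [/=|j _]; last by rewrite !exprn_ge0.
  apply: geometric_le; rewrite exprn_ge0 //=; apply: le_trans x1.
  by rewrite ler_iXnr // lt0n cards_eq0.
by rewrite -expR_sum -mulr_sumr sum_set_expr.
Qed.

End InvariantSets.

(** * Restriction to a Young subgroup and the power mean inequality *)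

Section Hoelder.

Variable R : realType.

(** Young's inequality t <= t ^ q / q + (1 - 1 / q) at t = v i / B, averaged with
the weights. *)
Lemma weighted_power_mean (I : finType) (A : pred I) (w v : I -> R) (q B : R) :
    1 < q -> 0 < B -> (forall i, A i -> 0 <= w i) -> (forall i, A i -> 0 <= v i) ->
    \sum_(i | A i) w i <= 1 -> \sum_(i | A i) w i * v i `^ q <= B `^ q ->
  \sum_(i | A i) w i * v i <= B.
Proof.
move=> q1 B0 w0 v0 sw1 swv.
have q0 : 0 < q by apply: lt_trans q1.
pose q' := (1 - q^-1)^-1.
have q'0 : 0 < 1 - q^-1 by rewrite subr_gt0 invf_lt1.
apply: (@le_trans _ _ (B * \sum_(i | A i) w i * ((v i / B) `^ q / q + (1 - q^-1)))).
  rewrite mulr_sumr; apply: ler_sum => i Ai; rewrite mulrCA ler_wpM2l ?w0 //.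
  have := @conjugate_powR R (v i / B) 1 q q'; rewrite powR1 /= mulr1 /q' div1r invrK.
  move=> young; rewrite -ler_pdivrMl // mulrC; apply: le_trans (young _ _ _ _ _) _ => //.
  - by rewrite divr_ge0 ?v0 // ltW.
  - by rewrite invr_gt0.
  - by rewrite addrC subrK.
rewrite ger_pMr //; under eq_bigr do rewrite mulrDr.
rewrite big_split /= -mulr_suml.
have -> : \sum_(i | A i) w i * ((v i / B) `^ q / q) =
    (\sum_(i | A i) w i * v i `^ q) / B `^ q / q.
  rewrite !mulr_suml; apply: eq_bigr => i Ai.
  rewrite powRM ?v0 ?invr_ge0 ?(ltW B0) //.
  by rewrite -(powR_inv1 (ltW B0)) -powRrM mulN1r powRN !mulrA.
apply: (@le_trans _ _ (q^-1 + (1 - q^-1))); last by rewrite addrC subrK.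
have Bq0 : 0 < B `^ q by apply: powR_gt0.
rewrite lerD //.
  by rewrite ler_piMl ?invr_ge0 ?(ltW q0) // ler_pdivrMr // mul1r.
by rewrite ler_piMl // ltW.
Qed.

End Hoelder.

Section Restriction.

Variables (R : realType) (T : finType) (L : {set T}).

Definition invariant_sets (g : {perm T}) := #|[set A : {set T} | (#|A| == #|L|) && (g @: A == A)]|.

Lemma invariant_setsJ (g x : {perm T}) : invariant_sets (g ^ x)%g = invariant_sets g.
Proof.
have le h y : (invariant_sets h <= invariant_sets (h ^ y)%g)%N.
  rewrite /invariant_sets -(card_imset _ (imset_inj (@perm_inj _ y))).
  apply/subset_leq_card/subsetP => _ /imsetP[A /[!inE] /andP[cA /eqP hA] ->].
  rewrite card_imset ?cA /=; last exact: perm_inj.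
  rewrite -imset_comp -[in X in _ == X]hA -imset_comp.
  by apply/eqP/eq_imset => z; rewrite /= conjgE !permM permK.
by apply/eqP; rewrite eqn_leq le -[X in (_ <= X)%N](congr1 invariant_sets (conjgK x g)) le.
Qed.

Lemma invariant_sets_gt0 g : g \in setwise_stab L -> (0 < invariant_sets g)%N.
Proof.
move=> /setwise_stabP gL; apply/card_gt0P; exists L; rewrite inE eqxx /=.
rewrite eqEcard card_imset ?leqnn ?andbT; last exact: perm_inj.
by apply/subsetP=> _ /imsetP[x Lx ->]; rewrite gL.
Qed.

(** An invariant set is determined by its intersection with L and by the rest,
which is invariant under a. *)
Lemma invariant_sets_split s a : s \in Sym L -> a \in Sym (~: L) ->
  (invariant_sets (s * a)%g <= 2 ^ #|L| * small_invariant (~: L) #|L| a)%N.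
Proof.
move=> Ls La; rewrite -card_powerset /small_invariant /invariant_sets -cardsX.
pose f (A : {set T}) := (A :&: L, A :\: L).
rewrite -(card_in_imset (f := f)); last first.
  by move=> A B _ _ [eqI eqD]; rewrite -(setID A L) eqI eqD setID.
apply/subset_leq_card/subsetP => _ /imsetP[A /[!inE] /andP[/eqP cardA /eqP gA] ->].
rewrite /= subsetIr subDset setUCr subsetT /= -cardA subset_leq_card ?subsetDl ?andbT //.
rewrite eqEcard card_imset ?leqnn ?andbT; last exact: perm_inj.
apply/subsetP=> _ /imsetP[x /setDP[Ax nLx] ->].
rewrite inE SymC_mem // nLx /= -gA; apply/imsetP; exists x => //.
by rewrite permM; congr (a _); move: Ls; rewrite inE => /out_perm ->.
Qed.

(** The permutations sending L to A form a coset of the stabilizer, or there are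
none. *)
Lemma card_transport (A : {set T}) :
  (#|[set x : {perm T} | x @: L == A]| <= #|setwise_stab L|)%N.
Proof.
have [->|[x0]] := set_0Vmem [set x : {perm T} | x @: L == A]; first by rewrite cards0.
rewrite inE => /eqP x0A; rewrite -(card_imset _ (mulIg x0^-1%g)).
apply/subset_leq_card/subsetP => _ /imsetP[x xA ->]; move: xA; rewrite inE => /eqP xA.
apply/setwise_stabP=> y; rewrite permM -(mem_imset L _ (@perm_inj _ x0)) permKV x0A -xA.
by rewrite mem_imset //; exact: perm_inj.
Qed.

(** Average over all conjugates of the stabilizer.  An element g lies in the
stabilizer of A exactly when A is one of its invariant sets, and each A comes
from at most #|setwise_stab L| conjugations, so the denominator cancels. *)
Lemma sum_restrict_le (f : {perm T} -> R) : (forall g, 0 <= f g) ->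
    (forall g x : {perm T}, f (g ^ x)%g = f g) ->
  #|T|`!%:R * (\sum_(g in setwise_stab L) f g / (invariant_sets g)%:R) <=
  #|setwise_stab L|%:R * \sum_g f g.
Proof.
move=> f0 fJ; pose phi g := f g / (invariant_sets g)%:R.
have phi0 g : 0 <= phi g by rewrite divr_ge0.
have phiJ g x : phi (g ^ x)%g = phi g by rewrite /phi fJ invariant_setsJ.
have cardT : #|T|`! = #|[set: {perm T}]| by rewrite -SymT perm.card_Sym cardsT.
have conj x : \sum_(g in setwise_stab L) phi g =
    \sum_(g | (g ^ x^-1)%g \in setwise_stab L) phi g.
  rewrite [RHS](reindex_inj (conjg_inj x)); apply: eq_big => [g|g _] //.
  by rewrite conjgK.
rewrite mulr_natl cardT -sumr_const (eq_bigr _ (fun x _ => conj x)).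
rewrite (exchange_big_dep xpredT) //= mulr_sumr; apply: ler_sum => g _.
rewrite sumr_const -[leLHS]mulr_natl.
have le_card : (#|[pred x in [set: {perm T}] | (g ^ x^-1)%g \in setwise_stab L]| <=
    invariant_sets g * #|setwise_stab L|)%N.
  rewrite -[X in (X <= _)%N]sum1_card (partition_big (fun x : {perm T} => x @: L)
    (fun A => A \in [set A : {set T} | (#|A| == #|L|) && (g @: A == A)])) /=; last first.
    move=> x; rewrite unfold_in /= => /andP[_ /setwise_stabP gx]; rewrite inE.
    rewrite card_imset ?eqxx /=; last exact: perm_inj.
    rewrite -imset_comp eqEcard (card_imset _ (@perm_inj _ x)).
    rewrite (card_imset _ (inj_comp (@perm_inj _ g) (@perm_inj _ x))) leqnn andbT.
    apply/subsetP=> _ /imsetP[y Ly ->] /=.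
    have := gx y; rewrite Ly conjgE invgK !permM => Ly'.
    by apply/imsetP; exists ((x^-1)%g (g (x y))); rewrite ?permKV.
  rewrite -sum_nat_const; apply: leq_sum => A _; apply: leq_trans (card_transport A).
  rewrite sum1_card; apply/subset_leq_card/subsetP => x.
  by rewrite !inE unfold_in /= => /andP[].
have [inv0|inv_gt0] := posnP (invariant_sets g).
  move: le_card; rewrite inv0 mul0n leqn0 => /eqP->.
  by rewrite mul0r !mulr_ge0 // invr_ge0.
rewrite -(ler_nat R) natrM in le_card.
apply: le_trans (ler_wpM2r (phi0 g) le_card) _.
by rewrite mulrC /phi mulrA divfK ?pnatr_eq0 -?lt0n // mulrC.
Qed.

Lemma invariant_sets_powR (q : R) (P : nat) s a : 1 <= q -> q - 1 <= P%:R ->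
    s \in Sym L -> a \in Sym (~: L) ->
  (invariant_sets (s * a)%g)%:R `^ (q - 1) <=
  (2 ^+ #|L|) `^ q * (small_invariant (~: L) #|L| a)%:R ^+ P.
Proof.
move=> q1 qP Ls La; have := invariant_sets_split Ls La; rewrite -(ler_nat R) natrM natrX => le_inv.
set n := small_invariant _ _ _ in le_inv *.
have q10 : 0 <= q - 1 by rewrite subr_ge0.
apply: (@le_trans _ _ ((2 ^+ #|L| * n%:R) `^ (q - 1))).
  by apply: ge0_ler_powR => //; rewrite nnegrE ?mulr_ge0 ?exprn_ge0.
rewrite powRM ?exprn_ge0 // ler_pM ?powR_ge0 //.
  by apply: ler_powR; rewrite ?exprn_ege1 ?ler1n // gerDl oppr_le0.
rewrite -powR_mulrn //; apply: ler_powR => //; rewrite ler1n.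
by apply/card_gt0P; exists set0; rewrite inE sub0set imset0 cards0 eqxx.
Qed.

(** The power mean inequality with weights f / N, whose total mass is at most 1 by
[sum_restrict_le], applied to h N, where N counts invariant sets.  On the
Young subgroup N ^ (q - 1) is bounded in terms of a alone, so the sum over
pairs factors. *)
Lemma restriction_bound (h f : {perm T} -> R) (M D q x : R) (P : nat) :
    2 <= q -> q - 1 <= P%:R -> 0 < x <= 2^-1 -> 1 <= D -> 0 < M ->
    (forall s, 0 <= h s <= D) -> \sum_(s in Sym L) h s ^+ 2 <= #|L|`!%:R ->
    (forall g, 0 <= f g <= M) -> (forall g y : {perm T}, f (g ^ y)%g = f g) ->
    \sum_g f g <= #|T|`!%:R ->
  (\sum_(s in Sym L) \sum_(a in Sym (~: L)) h s * f (s * a)%g) / #|setwise_stab L|%:R <=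
  (M * (2 ^+ #|L|) `^ q * (x ^- (#|L| * P) * expR (2 * (1 + x) ^+ P)) * D `^ (q - 2)) `^ q^-1.
Proof.
move=> q2 qP x01 D1 M0 hD sh fM fJ sf.
have q1 : 1 < q by apply: lt_le_trans q2; rewrite ltr1n.
set X := M * _ * _ * _; set B := X `^ q^-1.
have x0 : 0 < x by case/andP: x01.
have D0 : 0 < D by apply: lt_le_trans D1.
have q0 : 0 < q by apply: lt_trans q1.
have X0 : 0 < X.
  by rewrite !mulr_gt0 ?powR_gt0 ?exprn_gt0 ?invr_gt0 ?exprn_gt0 ?expR_gt0.
have B0 : 0 < B by rewrite powR_gt0.
have BX : B `^ q = X by rewrite /B -powRrM mulVf ?gt_eqF // powRr1 // ltW.
have cardH : (0 < #|setwise_stab L|)%N by rewrite card_setwise_stab muln_gt0 !cardG_gt0.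
pose w (u : {perm T} * {perm T}) := f (u.1 * u.2)%g / (invariant_sets (u.1 * u.2)%g)%:R / #|setwise_stab L|%:R.
pose v (u : {perm T} * {perm T}) := h u.1 * (invariant_sets (u.1 * u.2)%g)%:R.
pose A (u : {perm T} * {perm T}) := (u.1 \in Sym L) && (u.2 \in Sym (~: L)).
have inv0 u : A u -> (0 < invariant_sets (u.1 * u.2)%g)%N.
  case: u => s a /andP[/= Ls La]; apply/invariant_sets_gt0/setwise_stabP => y.
  by rewrite permM SymC_mem //; move: Ls; rewrite inE => /perm_closed->.
rewrite pair_big_dep mulr_suml /=.
rewrite (eq_bigr (fun u => w u * v u)) => [|u Au]; last first.
  have nz : (invariant_sets (u.1 * u.2)%g)%:R != 0 :> R by rewrite pnatr_eq0 -lt0n inv0.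
  by rewrite /w /v; field; rewrite nz pnatr_eq0 -lt0n cardH.
apply: (@weighted_power_mean R _ A w v q) => // [u _|u _||].
- by rewrite /w !divr_ge0 //; case/andP: (fM (u.1 * u.2)%g).
- by rewrite /v mulr_ge0 //; case/andP: (hD u.1).
- rewrite -mulr_suml ler_pdivrMr ?ltr0n // mul1r.
  rewrite -(pair_big_dep (mem (Sym L)) (fun _ => mem (Sym (~: L)))
     (fun s a => f (s * a)%g / (invariant_sets (s * a)%g)%:R)) /=.
  rewrite -(sum_setwise_stab L (fun g => f g / (invariant_sets g)%:R)).
  rewrite -(ler_pM2l (x := #|T|`!%:R)) ?ltr0n ?fact_gt0 //.
  apply: le_trans (sum_restrict_le _ fJ) _ => [g|]; first by case/andP: (fM g).
  by rewrite mulrC ler_pM2r // ltr0n.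
rewrite BX.
pose K := M * (2 ^+ #|L|) `^ q * D `^ (q - 2) / #|setwise_stab L|%:R.
have K0 : 0 <= K by rewrite !mulr_ge0 ?powR_ge0 ?invr_ge0 // ltW.
apply: (@le_trans _ _ (\sum_(u | A u) K * (h u.1 ^+ 2 * (small_invariant (~: L) #|L| u.2)%:R ^+ P))).
  apply: ler_sum => -[s a] Au; have /andP[/= Ls La] := Au.
  have /andP[h0 hs] := hD s; have /andP[f0 fs] := fM (s * a)%g.
  have N0 := inv0 _ Au; rewrite /w /v /= in N0 *.
  set N := invariant_sets _ in N0 *.
  have NR : (0 : R) < N%:R by rewrite ltr0n.
  rewrite powRM // ?ler0n // -[N%:R `^ q](mulr_powRB1 (ltW NR) q0).
  have hq : h s `^ q <= h s ^+ 2 * D `^ (q - 2).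
    have [->|hn0] := eqVneq (h s) 0; first by rewrite powR0 ?gt_eqF // expr0n mul0r.
    have -> : h s `^ q = h s `^ 2%:R * h s `^ (q - 2).
      by rewrite -powRD ?hn0 ?implybT // addrC subrK.
    rewrite powR_mulrn // ler_wpM2l ?exprn_ge0 // ge0_ler_powR ?subr_ge0 ?nnegrE // ltW //.
  rewrite [leLHS](_ : _ = f (s * a)%g * (h s `^ q * N%:R `^ (q - 1)) / #|setwise_stab L|%:R); last first.
    by field; rewrite !gt_eqF ?ltr0n.
  rewrite [leRHS](_ : _ = M * ((h s ^+ 2 * D `^ (q - 2)) *
     ((2 ^+ #|L|) `^ q * (small_invariant (~: L) #|L| a)%:R ^+ P)) / #|setwise_stab L|%:R); last first.
    by rewrite /K; ring.
  rewrite ler_wpM2r ?invr_ge0 // ler_pM ?mulr_ge0 ?powR_ge0 // ler_pM ?powR_ge0 //.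
  exact: invariant_sets_powR (ltW q1) qP Ls La.
rewrite -mulr_sumr.
rewrite -(pair_big_dep (mem (Sym L)) (fun _ => mem (Sym (~: L)))
  (fun s a => h s ^+ 2 * (small_invariant (~: L) #|L| a)%:R ^+ P)) /=.
rewrite -big_distrlr /=.
apply: (@le_trans _ _ (K * (#|L|`!%:R *
   (#|~: L|`!%:R * x ^- (#|L| * P) * expR (2 * (1 + x) ^+ P))))).
  rewrite ler_wpM2l // ler_pM //.
  - by apply: sumr_ge0 => s _; rewrite exprn_ge0 //; case/andP: (hD s).
  - by apply: sumr_ge0 => s _; rewrite exprn_ge0.
  exact: moment_small_invariant.
rewrite /K card_setwise_stab !perm.card_Sym natrM /X le_eqVlt; apply/orP; left; apply/eqP.
by field; rewrite !pnatr_eq0 -!lt0n !fact_gt0 expf_neq0 ?gt_eqF.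
Qed.

End Restriction.
(** * Numerical estimates *)

Section Constants.

Variable R : realType.

(** The choice of x makes (1 + x) ^ P <= exp (q x) <= q, so that the exponential
factor is absorbed by e ^ (2 d), while x ^ - 1 = 2 q / ln q.  Rounding q - 1
rather than q up to an integer keeps P <= q, so that x ^ (- d P) has q-th
root at most x ^ (- d). *)
Lemma hoelder_constant (q D : R) (d : nat) (x := ln q / (2 * q)) (P := (Num.truncn (q - 1)).+1) :
    2 <= q -> 1 <= D -> (0 < d)%N ->
  [/\ q - 1 <= P%:R, 0 < x <= 2^-1 &
    (expR (q * d%:R) * (2 ^+ d) `^ q * (x ^- (d * P) * expR (2 * (1 + x) ^+ P)) * D `^ (q - 2)) `^ q^-1
    <= (4 * expR 3 * q / ln q) ^+ d * D `^ (1 - 2 / q)].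
Proof.
move=> q2 D1 d_gt0.
have q1 : 1 < q by apply: lt_le_trans q2; rewrite ltr1n.
have q0 : 0 < q by apply: lt_trans q1.
have D0 : 0 < D by apply: lt_le_trans D1.
have lnq : 0 < ln q by rewrite ln_gt0.
have [P_le P_ge] : P%:R <= q /\ q - 1 <= P%:R.
  have /andP[le_t lt_t] : (Num.truncn (q - 1))%:R <= q - 1 < P%:R.
    by apply: truncn_itv; rewrite subr_ge0 ltW.
  by rewrite /P -natr1 -lerBrDr le_t natr1 ltW.
have x0 : 0 < x by rewrite divr_gt0 // mulr_gt0.
have x2 : x <= 2^-1.
  by rewrite /x invfM mulrCA ger_pMr ?invr_gt0 // ler_pdivrMr // mul1r ltW // ln_sublinear.
split; rewrite ?x0 ?x2 //.
pose y := x^-1.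
have y1 : 1 <= y by rewrite invf_ge1 //; apply: le_trans x2 _; rewrite invf_le1 // ler1n.
have y0 : 0 < y by rewrite invr_gt0.
have -> : 4 * expR 3 * q / ln q = 2 * expR 3 * y.
  by rewrite /y /x; field; rewrite !gt_eqF.
set B := _ ^+ d * D `^ _.
have B0 : 0 <= B by rewrite !(ltW y0, powR_ge0, exprn_ge0, expR_ge0, mulr_ge0).
suff le_Bq : expR (q * d%:R) * (2 ^+ d) `^ q * (x ^- (d * P) * expR (2 * (1 + x) ^+ P)) *
    D `^ (q - 2) <= B `^ q.
  have e1 : B = (B `^ q) `^ q^-1 by rewrite -powRrM mulfV ?lt0r_neq0 // powRr1.
  rewrite [leRHS]e1.
  rewrite ge0_ler_powR ?invr_ge0 ?nnegrE ?powR_ge0 // ?(ltW q0) //.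
  by rewrite !(ltW x0, powR_ge0, exprn_ge0, expR_ge0, invr_ge0, mulr_ge0).
have e0 := expR_ge0 (3 : R).
have -> : B `^ q = (2 ^+ d) `^ q * expR (3 * d%:R * q) * (y ^+ d) `^ q * D `^ (q - 2).
  rewrite /B powRM ?powR_ge0 ?exprn_ge0 ?mulr_ge0 ?(ltW y0) // -powRrM mulrBl mul1r divfK ?gt_eqF //.
  congr (_ * _); rewrite !exprMn !powRM ?mulr_ge0 ?exprn_ge0 ?(ltW y0) //.
  by rewrite -expRM_natr -expRM.
rewrite ler_wpM2r ?powR_ge0 // [_ * (2 ^+ d) `^ q]mulrC -!mulrA ler_wpM2l ?powR_ge0 //.
rewrite mulrCA [leRHS]mulrC ler_pM ?mulr_ge0 ?expR_ge0 //.
- by rewrite invr_ge0 exprn_ge0 // ltW.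
- rewrite -exprVn exprM -powR_mulrn ?exprn_ge0 ?(ltW y0) //.
  by apply: ler_powR => //; rewrite exprn_ege1.
rewrite -expRD ler_expR.
have le_xP : (1 + x) ^+ P <= q * d%:R.
  apply: (@le_trans _ _ q); last by rewrite ler_peMr ?(ltW q0) // ler1n.
  apply: (@le_trans _ _ (expR x ^+ P)).
    by rewrite lerXn2r ?nnegrE ?expR_ge0 ?expR_ge1Dx // addr_ge0 // ltW.
  rewrite -expRM_natr -[leRHS](@lnK _ q) ?posrE // ler_expR.
  apply: (@le_trans _ _ (x * q)); first by rewrite ler_wpM2l // ltW.
  by rewrite /x invfM mulrA mulfVK ?gt_eqF // ler_pdivrMr // ler_peMr ?ler1n // ltW.
by nra.
Qed.

(** For n <= 3 d the left-hand side is at most (3 d) ^ d.  Otherwise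
n <= 3 (n - d), and binomial N d is at least (N / d) ^ d for N = n - d. *)
Lemma binomial_lower (n m d : nat) : (m <= d)%N -> (d <= n - m)%N ->
  (n ^ d <= 3 ^ d * d ^ d * 'C(n - m, d))%N.
Proof.
move=> le_md le_dn.
have [le_n3d|lt_3dn] := leqP n (3 * d).
  rewrite -expnMn; apply: leq_trans (leq_pmulr _ _); last by rewrite bin_gt0.
  by case: (posnP d) => [->|d_gt0]; rewrite ?expn0 // leq_exp2r.
have powC N : (d <= N)%N -> (N ^ d <= d ^ d * 'C(N, d))%N.
  move=> le_dN; rewrite -(leq_pmul2r (fact_gt0 d)) -mulnA bin_ffact -ffactnn !ffact_prod.
  have powE k : (k ^ d = \prod_(i < d) k)%N by rewrite prod_nat_const card_ord.
  rewrite (powE N) (powE d) -!big_split /=.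
  apply: leq_prod => i _; rewrite !mulnBr [(d * N)%N]mulnC leq_sub2l //.
  by rewrite leq_mul2r le_dN orbT.
apply: (@leq_trans (3 ^ d * (n - d) ^ d)).
  rewrite -expnMn; case: (posnP d) => [->|d_gt0]; first by rewrite !expn0.
  by rewrite leq_exp2r //; lia.
rewrite -mulnA leq_mul2l; apply/orP; right.
apply: leq_trans (powC _ _) _; first by lia.
by rewrite leq_mul2l; apply/orP; right; rewrite leq_bin2l // leq_sub2l.
Qed.

Lemma dimension_transfer (n m d : nat) (D X q : R) : 2 <= q -> (0 < n)%N -> (0 < d)%N ->
    (m <= d)%N -> (d <= n - m)%N -> 0 <= D -> 'C(n - m, d)%:R * D <= X ->
  D `^ (1 - 2 / q) <= 3 ^+ d * (X * d%:R ^+ d / n%:R ^+ d) `^ (1 - 2 / q).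
Proof.
move=> q2 n0 d0 le_md le_dn D0 DX.
have q0 : 0 < q by apply: lt_le_trans q2.
have e0 : 0 <= 1 - 2 / q by rewrite subr_ge0 ler_pdivrMr // mul1r.
have X0 : 0 <= X by apply: le_trans DX; rewrite mulr_ge0.
have Y0 : 0 <= X * d%:R ^+ d / n%:R ^+ d by rewrite !mulr_ge0 ?invr_ge0 ?exprn_ge0.
have le_D : D <= 3 ^+ d * (X * d%:R ^+ d / n%:R ^+ d).
  rewrite mulrA ler_pdivlMr ?exprn_gt0 ?ltr0n //.
  apply: (@le_trans _ _ (3 ^+ d * (('C(n - m, d)%:R * D) * d%:R ^+ d))); last first.
    by rewrite ler_wpM2l ?exprn_ge0 // ler_wpM2r ?exprn_ge0.
  have := binomial_lower le_md le_dn; rewrite -(ler_nat R) !natrM !natrX => le_b.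
  by have := ler_wpM2l D0 le_b; congr (_ <= _); ring.
have le3 : D `^ (1 - 2 / q) <= (3 ^+ d * (X * d%:R ^+ d / n%:R ^+ d)) `^ (1 - 2 / q).
  by apply: ge0_ler_powR; rewrite ?nnegrE // mulr_ge0 ?exprn_ge0.
apply: le_trans le3 _; rewrite powRM ?exprn_ge0 // ler_wpM2r ?powR_ge0 //.
apply: ler1_powR; first by rewrite exprn_ege1 // ler1n.
by rewrite gerDl oppr_le0 divr_ge0 // ltW.
Qed.

End Constants.

(** * Exchanging rows and columns *)

Section Swap.

Variables (T : finType) (r c : T -> nat).
Hypotheses (rc_inj : injective_on setT r c).
Hypotheses (rc_just : left_justified setT r c) (cr_just : left_justified setT c r).

Lemma injective_on_swap : injective_on setT c r.
Proof. by move=> x y Sx Sy cxy rxy; apply: rc_inj. Qed.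

(** Inversion exchanges the order of the factors p and q, and the sign of p q is
the product of their signs. *)
Lemma young_swap (g : {perm T}) :
  young setT c r g = (-1) ^+ odd_perm g * young setT r c g^-1%g.
Proof.
transitivity (\sum_(q in stab_in setT c) \sum_(p in stab_in setT r)
  if (q * p)%g == g then (-1) ^+ odd_perm p else 0 : algC).
  by apply: eq_bigr => q _; rewrite big_mkcondr.
rewrite exchange_big /young mulr_sumr [RHS](reindex_inj invg_inj) /=.
apply: eq_big => [p|p _]; first by rewrite groupV.
rewrite mulr_sumr [RHS](reindex_inj invg_inj) [RHS]big_mkcondr /=.
apply: eq_big => [q|q _]; first by rewrite groupV.
rewrite -invMg (inj_eq invg_inj); case: eqP => // <-.
by rewrite odd_permV odd_permM signr_addb mulrAC -signr_addb addbb mul1r.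
Qed.

Lemma hook_const_swap : hook_const setT c r = hook_const setT r c.
Proof.
apply: eq_bigr => y _; rewrite !young_swap invgK odd_permV mulrACA -signr_addb addbb.
by rewrite mul1r mulrC.
Qed.

(** Up to inverting g, which does not matter since character values are real, this
is [young_swap] inserted in the trace formula. *)
Lemma full_char_swap (g : {perm T}) :
  full_char c r g = (-1) ^+ odd_perm g * full_char r c g.
Proof.
have cr_inj := injective_on_swap.
have G h : h \in [set: {perm T}] by rewrite inE.
have nz1 : young setT r c 1%g != 0 by rewrite young1 // oner_eq0.
have nz1' : young setT c r 1%g != 0 by rewrite young1 // oner_eq0.
have -> : full_char r c g = full_char r c g^-1%g.
  rewrite char_inv ?cfRepr_char //; apply/esym/CrealP.
  by rewrite Rreal_int // full_char_int.
rewrite /full_char (ideal_charE (full_quasi_idem rc_inj rc_just)) //.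
rewrite (ideal_charE (full_quasi_idem cr_inj cr_just)) // hook_const_swap [RHS]mulrCA.
congr (_ * _); rewrite mulr_sumr; apply: eq_bigr => x _.
by rewrite young_swap !invMg !invgK mulgA !odd_permM !odd_permV addbAC addbb.
Qed.

End Swap.

(** * The diagram of a partition *)

Section Diagram.

Variables (n : nat) (la : intpart n).
Let r (i : 'I_n) := reshape_index la i.
Let c (i : 'I_n) := reshape_offset la i.

Lemma sumn_part : sumn la = n.
Proof. by have /and3P[_ _ /eqP] := intpartP la. Qed.

Lemma part_pos k : (k < size la)%N -> (0 < nth 0%N la k)%N.
Proof.
have /and3P[_ /negP nz _] := intpartP la; move=> lt_k; rewrite lt0n.
by apply: contra_notN nz => /eqP <-; apply: mem_nth.
Qed.

Lemma part_sorted j k : (j <= k)%N -> (nth 0%N la k <= nth 0%N la j)%N.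
Proof.
move=> le_jk; have [lt_k|le_k] := ltnP k (size la); last by rewrite (nth_default _ le_k).
have /and3P[srt _ _] := intpartP la.
have geq_trans : transitive geq by move=> a b d ba ac; apply: leq_trans ac ba.
have geq_refl : reflexive geq by move=> a; apply: leqnn.
by apply: (sorted_leq_nth geq_trans geq_refl 0%N srt); rewrite ?inE ?(leq_ltn_trans le_jk).
Qed.

Let lt_sumn (i : 'I_n) : (i < sumn la)%N. Proof. by rewrite sumn_part. Qed.

Lemma cell_exists k j : (j < nth 0%N la k)%N -> exists i : 'I_n, r i = k /\ c i = j.
Proof.
move=> lt_j; have := flatten_indexP lt_j; rewrite sumn_part => lt_i.
by exists (Ordinal lt_i); rewrite /r /c /= flatten_indexKl ?flatten_indexKr.
Qed.

Lemma diagram_inj : injective_on setT r c.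
Proof.
move=> x y _ _ rxy cxy; apply: val_inj => /=.
by rewrite -(reshape_indexK la x) -(reshape_indexK la y) -/(r x) -/(c x) rxy cxy.
Qed.

Lemma diagram_left : left_justified setT r c.
Proof.
move=> x j _ lt_j; have lt_c := reshape_offsetP (lt_sumn x).
have [y [ry cy]] := cell_exists (ltn_trans lt_j lt_c).
by exists y; rewrite ?inE.
Qed.

Lemma diagram_top : left_justified setT c r.
Proof.
move=> x j _ lt_j; have lt_c := reshape_offsetP (lt_sumn x).
have [y [ry cy]] := cell_exists (leq_trans lt_c (part_sorted (ltnW lt_j))).
by exists y; rewrite ?inE.
Qed.

Lemma card_below_row : #|[set i | (0 < r i)%N]| = (n - head 0%N la)%N.
Proof.
have -> : [set i | (0 < r i)%N] = ~: [set i : 'I_n | (i < head 0%N la)%N].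
  apply/setP=> i; rewrite !inE lt0n -nth0; congr (~~ _); apply/eqP/idP => [r0|lt_i].
    have := reshape_offsetP (lt_sumn i); rewrite -/(r i) -/(c i) r0.
    have -> // : c i = i.
    by rewrite -[RHS](reshape_indexK la) -/(r i) -/(c i) r0 /flatten_index take0.
  by have := flatten_indexKl lt_i; rewrite /flatten_index take0 /= add0n.
have le_n : (head 0%N la <= n)%N.
  apply: leq_trans (_ : _ <= sumn la)%N _; last by rewrite sumn_part.
  by case: (parts la) => //= a s; apply: leq_addr.
rewrite cardsCs setCK card_ord; congr (n - _)%N.
have -> : [set i : 'I_n | (i < head 0%N la)%N] = [set widen_ord le_n j | j in 'I_(head 0%N la)].
  apply/setP=> i; rewrite inE; apply/idP/imsetP => [lt_i|[j _ ->]]; last by rewrite /= ltn_ord.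
  by exists (Ordinal lt_i) => //; apply: val_inj.
by rewrite card_imset ?card_ord // => j k /(congr1 val)/= jk; apply: val_inj.
Qed.

Lemma card_right_col : #|[set i | (0 < c i)%N]| = (n - size la)%N.
Proof.
rewrite cardsCs card_ord; congr (n - _)%N.
have [h hP] := fin_all_exists (fun k : 'I_(size la) => cell_exists (part_pos (ltn_ord k))).
have -> : ~: [set i | (0 < c i)%N] = [set h k | k in 'I_(size la)].
  apply/setP=> i; rewrite !inE lt0n negbK; apply/eqP/imsetP => [c0|[k _ ->]]; last by case: (hP k).
  have lt_r := reshape_indexP (lt_sumn i); exists (Ordinal lt_r) => //.
  have [rh ch] := hP (Ordinal lt_r).
  by apply: diagram_inj; rewrite ?inE // ?rh ?ch.
rewrite card_imset ?card_ord // => j k eq_h; apply: val_inj.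
by rewrite /= -[LHS](hP j).1 -[RHS](hP k).1 eq_h.
Qed.

Lemma chi_full_char : chi la = full_char r c.
Proof.
rewrite /chi /specht_repr; suff -> : young_symmetrizer la = gal_row [set: 'S_n]%G (young setT r c) by [].
have Rs : row_stab la =i stab_in setT r.
  move=> p; rewrite inE; apply/forallP/stab_inP => [rp|[_ rp] i]; last exact/eqP/rp.
  by rewrite SymT inE; split=> // i; apply/eqP/rp.
have Cs : col_stab la =i stab_in setT c.
  move=> p; rewrite inE; apply/forallP/stab_inP => [rp|[_ rp] i]; last exact/eqP/rp.
  by rewrite SymT inE; split=> // i; apply/eqP/rp.
apply/rowP=> j; rewrite mxE summxE (eq_bigl _ _ Rs); apply: eq_bigr => p _.
rewrite summxE (eq_bigl _ _ Cs) big_mkcondr /=; apply: eq_bigr => q _.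
rewrite !mxE eqxx /= -(inj_eq enum_val_inj) gring_indexK ?inE // [_ == enum_val j]eq_sym.
by case: eqP; rewrite ?mulr1 ?mulr0.
Qed.

End Diagram.

(** * The bound on Kronecker coefficients *)

Section KroneckerBound.

Variables (R : realType) (T : finType) (r c : T -> nat).
Hypotheses (rc_inj : injective_on setT r c) (rc_just : left_justified setT r c).
Let L := [set x | 0 < r x]%N.

Lemma int_valued (gT : finGroupType) (G : {group gT}) (chi : 'CF(G)) :
  (forall g, chi g \in Num.int) -> exists z : gT -> int, forall g, chi g = (z g)%:~R.
Proof.
by move=> chi_int; exists (fun g => Num.floor (chi g)) => g; rewrite floorK.
Qed.

Lemma int_char_sum_sqr (gT : finGroupType) (G : {group gT}) (chi : 'CF(G)) (z : gT -> int) :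
  '[chi] = 1 -> (forall g, chi g = (z g)%:~R) -> \sum_(g in G) z g ^+ 2 = #|G|%:Z.
Proof.
move=> norm1 chiz; apply: (@intr_inj algC).
have nzG : (#|G|%:R : algC) != 0 by rewrite pnatr_eq0 -lt0n cardG_gt0.
move: norm1; rewrite cfdotE => /(canRL (mulKf (invr_neq0 nzG))).
rewrite invrK mulr1 -pmulrn => <-; rewrite rmorph_sum /=.
by apply: eq_bigr => g _; rewrite chiz conj_intr // rmorphXn.
Qed.

Lemma int_char_le (gT : finGroupType) (G : {group gT}) (chi : 'CF(G)) (z : gT -> int) g :
  chi \is a character -> (forall g, chi g = (z g)%:~R) -> `|z g| <= z 1%g.
Proof.
move=> char_chi chiz; rewrite -(ler_int algC) intr_norm -!chiz.
exact: char1_ge_norm.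
Qed.

Lemma int_char_cfunJ (gT : finGroupType) (chi : 'CF([set: gT])) (z : gT -> int) g x :
  (forall g, chi g = (z g)%:~R) -> z (g ^ x)%g = z g.
Proof. by move=> chiz; apply: (@intr_inj algC); rewrite -!chiz cfunJ ?inE. Qed.

(** The characters al and be are arbitrary irreducible ones, because in the column
case one of them carries a sign twist. *)
Lemma kronecker_bound (al be : 'CF([set: {perm T}])) (K A B X d : nat) (q : R) :
    al \is a character -> be \is a character -> '[al] = 1 -> '[be] = 1 ->
    (forall g, al g \in Num.int) -> (forall g, be g \in Num.int) ->
    al 1%g = A%:R -> be 1%g = B%:R ->
    full_char r c 1%g = X%:R -> '[full_char r c * (al * be), 1] = K%:R ->
    (0 < d)%N -> #|L| = d -> q = ln (A%:R * B%:R) / d%:R -> 2 <= q ->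
  K%:R <= (12 * expR 3 * q / ln q) ^+ d * (X%:R * d%:R ^+ d / #|T|%:R ^+ d) `^ (1 - 2 / q).
Proof.
move=> char_al char_be al_norm be_norm al_int be_int alA beB defX defK d_gt0 cardL def_q q2.
have [za alE] := int_valued al_int; have [zb beE] := int_valued be_int.
pose lo := young_char L r c.
have lo_inj := lower_inj rc_inj; have lo_just := lower_just rc_just.
have char_lo : lo \is a character by apply: cfRepr_char.
have lo_norm : '[lo] = 1 := young_char_norm lo_inj lo_just.
have [zl loE] := int_valued (young_char_int lo_inj lo_just).
pose D := \rank (lmul_mx (Sym_group L) (young L r c)).
have loD : zl 1%g = D%:Z by apply: (@intr_inj algC); rewrite -loE ideal_char1.
have zaA : za 1%g = A%:Z by apply: (@intr_inj algC); rewrite -alE alA.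
have zbB : zb 1%g = B%:Z by apply: (@intr_inj algC); rewrite -beE beB.
have D_gt0 : (0 < D)%N.
  rewrite lt0n; apply/eqP => D0.
  have : lo == 0 by rewrite -char1_eq0 // [lo _]loE loD D0.
  by move/eqP=> lo0; move: lo_norm => /eqP; rewrite lo0 cfdot0l eq_sym oner_eq0.
have n_gt0 : (0 < #|T|)%N by rewrite (leq_trans d_gt0) // -cardL max_card.
pose N := #|setwise_stab L|.
have N_gt0 : (0 < N)%N by rewrite /N card_setwise_stab muln_gt0 !cardG_gt0.
have le_int : K%:Z * N%:Z <= \sum_(s in Sym L) \sum_(a in Sym (~: L)) zl s * (za (s * a)%g * zb (s * a)%g).
  rewrite -(ler_int algC) rmorphM /= -!pmulrn -defK -ler_pdivlMr ?ltr0n //.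
  have := multiplicity_le rc_inj rc_just (rpredM char_al char_be).
  rewrite -card_setwise_stab -/N => /le_trans; apply; rewrite [leRHS]mulrC ler_pM2l ?invr_gt0 ?ltr0n //.
  rewrite le_eqVlt; apply/orP; left; apply/eqP.
  rewrite rmorph_sum; apply: eq_bigr => s _; rewrite rmorph_sum; apply: eq_bigr => a _.
  by rewrite /= !rmorphM /= -loE -alE -beE [(al * be) _]cfunE.
pose h s : R := `|zl s|%:~R.
pose f g : R := (`|za g| * `|zb g|)%:~R.
have le_K : K%:R <= (\sum_(s in Sym L) \sum_(a in Sym (~: L)) h s * f (s * a)%g) / N%:R.
  rewrite ler_pdivlMr ?ltr0n //.
  have := le_int; rewrite -(ler_int R) rmorphM /= => /le_trans; apply.
  rewrite rmorph_sum; apply: ler_sum => s _; rewrite rmorph_sum; apply: ler_sum => a _.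
  by rewrite /h /f -rmorphM /= (ler_int R) -!normrM ler_norm.
have A_gt0 : (0 < A)%N.
  rewrite lt0n; apply/eqP => A0.
  have /eqP al0 : al == 0 by rewrite -char1_eq0 // alA A0.
  by move: al_norm => /eqP; rewrite al0 cfdot0l eq_sym oner_eq0.
have B_gt0 : (0 < B)%N.
  rewrite lt0n; apply/eqP => B0.
  have /eqP be0 : be == 0 by rewrite -char1_eq0 // beB B0.
  by move: be_norm => /eqP; rewrite be0 cfdot0l eq_sym oner_eq0.
have expM : expR (q * d%:R) = A%:R * B%:R :> R.
  by rewrite def_q divfK ?pnatr_eq0 -?lt0n // lnK // posrE mulr_gt0 ?ltr0n.
have D1 : 1 <= D%:R :> R by rewrite ler1n.
have [P_ge x01 le_const] := hoelder_constant q2 D1 d_gt0.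
have hD s : 0 <= h s <= D%:R.
  have le_s : `|zl s| <= D%:Z by rewrite -loD (int_char_le _ char_lo loE).
  by rewrite -(ler_int R) in le_s; rewrite /h ler0z normr_ge0 le_s.
have fM g : 0 <= f g <= expR (q * d%:R).
  have le_f : `|za g| * `|zb g| <= A%:Z * B%:Z.
    rewrite ler_pM // -?zaA -?zbB; first exact: int_char_le char_al alE.
    exact: int_char_le char_be beE.
  by rewrite -(ler_int R) [X in _ <= X]rmorphM in le_f; rewrite expM /f ler0z mulr_ge0 // le_f.
have fJ (g y : {perm T}) : f (g ^ y)%g = f g.
  by rewrite /f (int_char_cfunJ _ _ alE) (int_char_cfunJ _ _ beE).
have sum_h : \sum_(s in Sym L) h s ^+ 2 <= #|L|`!%:R.
  have le_s : \sum_(s in Sym L) `|zl s| ^+ 2 <= #|L|`!%:Z.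
    rewrite -perm.card_Sym -(int_char_sum_sqr lo_norm loE).
    by apply: ler_sum => s _; rewrite real_normK ?num_real.
  rewrite -(ler_int R) rmorph_sum in le_s; apply: le_trans le_s.
  by apply: ler_sum => s _; rewrite /h -rmorphXn.
have cardT : #|[set: {perm T}]| = #|T|`! by rewrite -SymT perm.card_Sym cardsT.
have sum_f : \sum_g f g <= #|T|`!%:R.
  have le_f : \sum_g `|za g| * `|zb g| <= #|T|`!%:Z.
    rewrite -(ler_pM2l (x := 2)) //.
    rewrite [leRHS]mulr_natl mulr2n -cardT.
    rewrite -[X in _ <= X + _](int_char_sum_sqr al_norm alE).
    rewrite -[X in _ <= _ + X](int_char_sum_sqr be_norm beE) -big_split /= mulr_sumr.
    rewrite [leRHS](eq_bigl xpredT) => [|g]; last by rewrite inE.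
    apply: ler_sum => g _; rewrite -[za g ^+ 2]real_normK ?num_real // -[zb g ^+ 2]real_normK ?num_real //.
    by have := sqr_ge0 (`|za g| - `|zb g|); lia.
  by rewrite -(ler_int R) rmorph_sum in le_f.
have dim : 'C(#|T| - #|[set x | (r x == 0)%N && [exists y in L, c y == c x]]|, d)%:R * D%:R <= X%:R :> R.
  rewrite -natrM ler_nat -cardL.
  have -> : X = \rank (lmul_mx [set: {perm T}]%G (young setT r c)).
    by apply/eqP; rewrite -(eqr_nat algC) -defX ideal_char1.
  exact: young_rank_lower.
have le_md := card_covered rc_inj; rewrite -/L cardL in le_md.
set U := [set x | _] in dim le_md.
have le_dU : (d <= #|T| - #|U|)%N.
  rewrite -cardL -(cardsC L) -addnBA ?leq_addr //; apply/subset_leq_card/subsetP => x.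
  by rewrite !inE => /andP[/eqP->].
have le_D := dimension_transfer q2 n_gt0 d_gt0 le_md le_dU (ler0n R D) dim.
have step := restriction_bound q2 P_ge x01 D1 (expR_gt0 _) hD sum_h fM fJ sum_f.
rewrite cardL in step.
apply: le_trans le_K (le_trans step (le_trans le_const _)).
have -> : 12 * expR 3 * q / ln q = 4 * expR 3 * q / ln q * 3 :> R.
  by move: (expR 3) ((ln q)^-1) => e z; ring.
have W0 : 0 <= 4 * expR 3 * q / ln q.
  have q1 : 1 < q by apply: lt_le_trans q2; rewrite ltr1n.
  by rewrite !mulr_ge0 ?expR_ge0 ?invr_ge0 ?ln_ge0 ?ltW // (lt_trans _ q1).
move: (_ * q / ln q) W0 => W W0.
by rewrite exprMn -[leRHS]mulrA ler_wpM2l ?exprn_ge0.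
Qed.

End KroneckerBound.

Theorem corollary2p4 (R : realType) :
  exists C : R, 0 < C /\
    forall (n d : nat) (la mu nu : intpart n) (q : R),
      (0 < d)%N -> level la = d ->
      q = ln ((chi_deg mu)%:R * (chi_deg nu)%:R) / d%:R ->
      2 <= q ->
      (kron la mu nu)%:R <=
        (C * q / ln q) ^+ d *
        ((chi_deg la)%:R * d%:R ^+ d / n%:R ^+ d) `^ (1 - 2 / q).
Proof.
exists (12 * expR 3); split=> [|n d la mu nu q d_gt0 def_d def_q q2].
  by rewrite mulr_gt0 ?expR_gt0.
pose r (k : intpart n) (i : 'I_n) := reshape_index k i.
pose c (k : intpart n) (i : 'I_n) := reshape_offset k i.
have inj k : injective_on setT (r k) (c k) := @diagram_inj n k.
have left k : left_justified setT (r k) (c k) := @diagram_left n k.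
have top k : left_justified setT (c k) (r k) := @diagram_top n k.
have inj' k : injective_on setT (c k) (r k) := injective_on_swap (inj k).
have chiE k : chi k = full_char (r k) (c k) := chi_full_char k.
have kronE' : (kron la mu nu)%:R = '[chi la * (chi mu * chi nu), 1] :> algC.
  by rewrite kronE kronecker_cfdot mulrA.
have [le_row|/ltnW le_col] := leqP (n - head 0%N la) (n - size la).
  have := @kronecker_bound R _ (r la) (c la) (inj la) (left la) (chi mu) (chi nu)
    (kron la mu nu) (chi_deg mu) (chi_deg nu) (chi_deg la) d q.
  rewrite card_ord -chiE !chi_degE; apply; rewrite ?chi_char //.
  - by rewrite chiE full_char_norm.
  - by rewrite chiE full_char_norm.
  - by move=> g; rewrite chiE full_char_int.
  - by move=> g; rewrite chiE full_char_int.
  by rewrite -def_d /level (minn_idPl le_row); apply: card_below_row.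
pose sg : 'CF([set: 'S_n]) := full_char (c mu) (r mu).
have sgE g : sg g = (-1) ^+ odd_perm g * chi mu g.
  by rewrite chiE; apply: full_char_swap.
have laE g : full_char (c la) (r la) g = (-1) ^+ odd_perm g * chi la g.
  by rewrite chiE; apply: full_char_swap.
have sg_char : sg \is a character by apply: cfRepr_char.
have sg_norm : '[sg] = 1 := full_char_norm (inj' mu) (top mu).
have sg_int g : sg g \in Num.int := full_char_int (inj' mu) (top mu) g.
clearbody sg.
have := @kronecker_bound R _ (c la) (r la) (inj' la) (top la) sg (chi nu)
  (kron la mu nu) (chi_deg mu) (chi_deg nu) (chi_deg la) d q.
rewrite card_ord; apply => //.
- exact: chi_char.
- by rewrite chiE full_char_norm.
- by move=> g; rewrite chiE full_char_int.
- by rewrite sgE odd_perm1 mul1r chi_degE.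
- by rewrite chi_degE.
- by rewrite laE odd_perm1 mul1r chi_degE.
- rewrite kronE'; congr '[_, 1]; apply/cfunP => g.
  rewrite [LHS]cfunE [(sg * _) g]cfunE [RHS]cfunE [(chi mu * _) g]cfunE sgE laE.
  by rewrite -[_ * chi mu g * _]mulrA mulrACA -signr_addb addbb mul1r.
by rewrite -def_d /level (minn_idPr le_col); apply: card_right_col.
Qed.
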